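(* Let $m\ge 2$ be an integer. The critical value function $\tau_m:(1,2]\to[0,1)$ has $\psi(m)$ discontinuity points, namely the points $\beta_{m,k_1,\ldots,k_j}$ with $(m,k_1,\ldots,k_j)\in\mathcal A_m$, and for $(m,k_1,\ldots,k_j),(m,k_1',\ldots,k_l')\in\mathcal A_m$, $$\beta_{m,k_1,\ldots,k_j}<\beta_{m,k_1',\ldots,k_l'}\iff (m,k_1,\ldots,k_j)\prec(m,k_1',\ldots,k_l').$$ Furthermore, $\tau_m$ is determined as follows. (i) If $1<\beta\le\beta_{m,1}$, then $\tau_m(\beta)=0$. (ii) If $\beta_{m,m-1}<\beta\le 2$, then $\tau_m(\beta)=(\mathbf w_{(m-1)/m}^\infty)_\beta$. (iii) If $(m,k_1,\ldots,k_j)\in\mathcal A_m\setminus\{(m,m-1)\}$ and $\beta\in I_{m,k_1,\ldots,k_j}$, then $$\tau_m(\beta)=\big((\mathbf w_{k_1/m_1}\bullet\mathbf w_{k_2/m_2}\bullet\cdots\bullet\mathbf w_{k_j/m_j})^\infty\big)_\beta,$$ where $m_1=m$ and $m_i=\gcd(m,k_1,\ldots,k_{i-1})$ for $2\le i\le j$.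
   Context: Critical value. For $\beta\in(1,2]$ let $T_\beta:[0,1)\to[0,1)$, $x\mapsto\beta x \pmod 1$, and for $t\in[0,1)$ let $K_\beta(t)=\{x\in[0,1):T_\beta^n(x)\notin(0,t)\ \forall n\ge0\}$. A periodic point $x\in K_\beta(t)$ has smallest period $m$ if $T_\beta^m(x)=x$ and $T_\beta^i(x)\ne x$ for $1\le i<m$; then $\{T_\beta^n(x)\}_{n\ge 0}$ is a periodic orbit of smallest period $m$. Define $\tau_m(\beta)=\sup\{t\in[0,1):K_\beta(t)\text{ contains a periodic orbit of smallest period }m\}$, with $\sup\emptyset=0$. Admissible chains. $\mathcal A_m$ is the set of admissible $m$-chains: vectors $(m,k_1,\ldots,k_\ell)$ of positive integers with $k_i<m_i:=\gcd(m,k_1,\ldots,k_{i-1})$ for all $1\le i\le\ell$ (where $m_1=m$) and $\gcd(m,k_1,\ldots,k_\ell)=1$. For vectors of positive integers, $(a_1,\ldots,a_j)\prec(b_1,\ldots,b_l)$ means that there is $n\le\min\{j,l\}$ with $a_i=b_i$ for $i<n$ and $a_n<b_n$. On $\mathcal A_m$ this is a total order with smallest element $(m,1)$ and largest element $(m,m-1)$. The function $\psi$ is defined by $\psi(1)=1$ and $\psi(n)=\sum_{k=1}^{n-1}\psi(\gcd(n,k))$ for $n\ge2$. Words. $\{0,1\}^*$ is the set of finite words over $\{0,1\}$. For a word $\mathbf w$, $\mathbf w^\infty=\mathbf w\mathbf w\cdots$, and $\mathbb L(\mathbf w)$ is the lexicographically largest cyclic permutation of $\mathbf w$. If $\mathbf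 w$ ends with $0$, $\mathbf w^+$ is $\mathbf w$ with last digit changed to $1$; if $\mathbf w$ ends with $1$, $\mathbf w^-$ is $\mathbf w$ with last digit changed to $0$. For $\beta\in(1,2]$ and $(d_i)\in\{0,1\}^{\mathbb N}$, $((d_i))_\beta=\sum_{i\ge1}d_i\beta^{-i}$. Farey words. For a rational $p/q\in(0,1)$ with $\gcd(p,q)=1$, let $R_{p/q}:\mathbb R/\mathbb Z\to\mathbb R/\mathbb Z$, $x\mapsto x+p/q \pmod 1$. The Farey word $\mathbf w_{p/q}=w_1\ldots w_q$ is given by $w_k=1$ if $0\in(R_{p/q}^{k-1}(0),R_{p/q}^k(0)]$ (arc of the circle), and $w_k=0$ otherwise; equivalently $w_k=\lfloor kp/q\rfloor-\lfloor (k-1)p/q\rfloor$. If $\gcd(p,q)=d>1$, $\mathbf w_{p/q}:=\mathbf w_{(p/d)/(q/d)}$. Lyndon words and substitution. A word is a Lyndon word if it is not a proper power of a shorter word and is the lexicographically smallest of its cyclic permutations; Farey words of length at least two are Lyndon words. For a Lyndon word $\mathbf s$ of length at least two (it begins with $0$ and ends with $1$) and $\mathbf r=r_1\ldots r_n\in\{0,1\}^*$, define $\mathbf s\bullet\mathbf r=\mathbf w_1\ldots\mathbf w_n$, where $\mathbf w_1=\mathbf s^-$ if $r_1=0$, $\mathbf w_1=\mathbb L(\mathbf s)^+$ if $r_1=1$, and for $1\le k<n$, $\mathbf w_{k+1}$ equals $\mathbb L(\mathbf s)$, $\mathbb L(\mathbf s)^+$, $\mathbf s^-$, $\mathbf s$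 according as $r_kr_{k+1}=00,01,10,11$. The operation $\bullet$ is associative on Lyndon words of length at least two. Bases and partition intervals. For $(m,k_1,\ldots,k_j)\in\mathcal A_m$, $\beta_{m,k_1,\ldots,k_j}$ is the largest $\beta\in(1,2)$ satisfying $(\mathbb L(\mathbf w_{k_1/m_1}\bullet\cdots\bullet\mathbf w_{k_j/m_j})^\infty)_\beta=1$. For $(m,k_1,\ldots,k_j)\in\mathcal A_m\setminus\{(m,m-1)\}$, the $m$-partition interval is $I_{m,k_1,\ldots,k_j}=(\beta_{m,k_1,\ldots,k_j},\beta_{m,k_1',\ldots,k_l'}]$, where $(m,k_1',\ldots,k_l')$ is the immediate successor of $(m,k_1,\ldots,k_j)$ in $(\mathcal A_m,\prec)$. *)

(* Defs.v *)
From HB Require Import structures.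
From mathcomp Require Import all_boot all_order all_algebra.
From mathcomp Require Import all_classical all_reals all_analysis.
Import Order.TTheory GRing.Theory Num.Theory.
Import numFieldNormedType.Exports.

Set Implicit Arguments.
Unset Strict Implicit.
Unset Printing Implicit Defensive.

Local Open Scope classical_set_scope.
Local Open Scope ring_scope.

Definition beta_map {R : realType} (b x : R) : R :=
  b * x - (Num.floor (b * x))%:~R.

Definition survivor_set {R : realType} (b t : R) : set R :=
  [set x | 0 <= x < 1 /\ forall n, ~~ (0 < iter n (beta_map b) x < t)].

Definition has_smallest_period {R : realType} (b : R) (m : nat) (x : R) : Prop :=
  [/\ (0 < m)%N, iter m (beta_map b) x = x
    & forall i, (1 <= i < m)%N -> iter i (beta_map b) x <> x].

Definition orbit_of {R : realType} (b x : R) : set R :=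
  [set iter n (beta_map b) x | n in [set: nat]].

(* [sup set0 = 0] in the library, which is the convention wanted here. *)
Definition tau {R : realType} (m : nat) (b : R) : R :=
  sup [set t | 0 <= t < 1 /\
    exists2 x, has_smallest_period b m x &
               orbit_of b x `<=` survivor_set b t].

(* Continuity is relative to the domain [A], so one-sided at its endpoints. *)
Definition discontinuities {R : realType} (A : set R) (f : R -> R) : set R :=
  [set x | A x /\ ~ (f y @[y --> within A (nbhs x)] --> f x)].

(* 0 is false and 1 is true. *)
Notation word := (seq bool).

Definition set_last (w : word) (a : bool) : word :=
  set_nth false w (size w).-1 a.

Definition wplus (w : word) : word := set_last w true.
Definition wminus (w : word) : word := set_last w false.

Definition wpow (w : word) : nat -> bool :=
  fun i => nth false w (i %% size w).

(* [seqlexi bool] is [seq bool] with the lexicographic order, false < true. *)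
Definition max_rot (w : word) : word :=
  \big[Order.max/(w : seqlexi bool)]_(i < size w) (rot i w : seqlexi bool).

(* Digits are indexed from 0, hence the shifted exponent. *)
Definition expansion {R : realType} (d : nat -> bool) (b : R) : R :=
  limn (series (fun i => (nat_of_bool (d i))%:R / b ^+ i.+1)).

(* The k-th digit is floor(kp/q) - floor((k-1)p/q), for k = 1, ..., q. *)
Definition farey_coprime (p q : nat) : word :=
  mkseq (fun k => (k.+1 * p %/ q - k * p %/ q == 1)%N) q.

Definition farey (p q : nat) : word :=
  farey_coprime (p %/ gcdn p q) (q %/ gcdn p q).

Definition subst_block (s : word) (a b : bool) : word :=
  match a, b with
  | false, false => max_rot s
  | false, true => wplus (max_rot s)
  | true, false => wminus s
  | true, true => s
  end.

(* Only meaningful when [s] is a Lyndon word of length at least two. *)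
Definition bullet (s r : word) : word :=
  if r is r1 :: r' then
    flatten ((if r1 then wplus (max_rot s) else wminus s)
               :: pairmap (subst_block s) r1 r')
  else [::].

(* The bracketing is immaterial on Lyndon words of length at least two, where
   [bullet] is associative.  It has no unit word, hence the case of one word. *)
Fixpoint bullets (ws : seq word) : word :=
  match ws with
  | [::] => [::]
  | [:: w] => w
  | w :: ws' => bullet w (bullets ws')
  end.

(* A chain is the full vector (m, k_1, ..., k_l), so that [nth 0 c i] is k_i and
   [chain_gcd c i] is m_i = gcd(m, k_1, ..., k_(i-1)) for i >= 1. *)
Definition chain_gcd (c : seq nat) (i : nat) : nat :=
  (\big[gcdn/0]_(a <- take i c) a)%N.

Definition admissible (m : nat) : set (seq nat) :=
  [set c | [/\ ohead c = Some m,
               forall i, (1 <= i < size c)%N ->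
                 (0 < nth 0 c i < chain_gcd c i)%N
             & chain_gcd c (size c) = 1%N]].

Definition chain_lt (c c' : seq nat) : Prop :=
  exists n, [/\ (n < minn (size c) (size c'))%N,
    forall i, (i < n)%N -> nth 0%N c i = nth 0%N c' i
    & (nth 0 c n < nth 0 c' n)%N].

Definition immediate_succ (m : nat) (c c' : seq nat) : Prop :=
  [/\ admissible m c, admissible m c', chain_lt c c'
    & ~ exists c'', [/\ admissible m c'', chain_lt c c'' & chain_lt c'' c']].

Definition chain_word (c : seq nat) : word :=
  bullets [seq farey (nth 0%N c i) (chain_gcd c i) | i <- iota 1 (size c).-1].

(* The largest element of the set of bases in (1,2) solving the equation;
   [xget] would return 0 if there were none. *)
Definition chain_base {R : realType} (c : seq nat) : R :=
  let S := [set b : R | 1 < b < 2 /\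
                        expansion (wpow (max_rot (chain_word c))) b = 1] in
  xget 0 (S `&` ubound S).

Definition partition_interval {R : realType} (m : nat) (c : seq nat) : set R :=
  [set b | exists2 c', immediate_succ m c c' &
                       chain_base c < b <= chain_base c'].

(* The first argument is fuel; see [psi1] and [psiE] for the recursion. *)
Fixpoint psi_fuel (f n : nat) : nat :=
  match f with
  | 0 => 0
  | f'.+1 => if (n <= 1)%N then n
             else (\sum_(1 <= k < n) psi_fuel f' (gcdn n k))%N
  end.

Definition psi (n : nat) : nat := psi_fuel n n.

Lemma psi_fuel_enough f n : (n <= f)%N -> psi_fuel f n = psi n.
Proof.
elim/ltn_ind: n f => -[|n] IHn [|f] //= lenf.
rewrite /psi /=; case: ifP => // _.
apply: eq_big_nat => k /andP[k0 kn].
have kd : (gcdn n.+1 k <= k)%N by exact: dvdn_leq (dvdn_gcdr _ _).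
have lt : (gcdn n.+1 k < n.+1)%N by exact: leq_ltn_trans kn.
by rewrite !IHn // -ltnS; exact: leq_trans lenf.
Qed.

Lemma psi1 : psi 1 = 1%N. Proof. by []. Qed.

Lemma psiE n : (2 <= n)%N -> psi n = (\sum_(1 <= k < n) psi (gcdn n k))%N.
Proof.
case: n => [|n] // n1; rewrite {1}/psi /= leqNgt n1 /=.
apply: eq_big_nat => k /andP[k0 kn]; apply: psi_fuel_enough.
have kd : (gcdn n.+1 k <= k)%N by exact: dvdn_leq (dvdn_gcdr _ _).
by rewrite -ltnS; exact: leq_ltn_trans kn.
Qed.

(* Main.v *)
Require Import Defs.
From HB Require Import structures.
From mathcomp Require Import all_boot all_order all_algebra.
From mathcomp Require Import all_classical all_reals all_analysis.
From mathcomp Require Import finmap zify ring lra.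
Import Order.TTheory GRing.Theory Num.Theory.
Import numFieldNormedType.Exports.

Set Implicit Arguments.
Unset Strict Implicit.
Unset Printing Implicit Defensive.

(** A point with a periodic orbit of smallest period [m >= 2] lies in the
    survivor set of [t] exactly when every point of its orbit is at least [t],
    so [tau m b] is the greatest possible minimum of such an orbit, and 0 if
    there is no such orbit.  The digits of an orbit form a sequence [y], periodic
    of smallest period [m], and the points of the orbit are the values in base
    [b] of the shifts of [y]; conversely [y] comes from an orbit as soon as
    all these values are below 1 ([mem_tau_set]).  Values below 1 are ordered
    as the sequences are ordered lexicographically, and it suffices that the
    largest shift has value below 1 ([realized_slt], [realized_below]).
    Computing [tau] is thus the combinatorial problem of finding the orbits whose
    smallest sequence is as large as possible and whose largest sequence is as
    small as possible.

    Let [k] be the number of ones of [y] in a period, and let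
    [0u1] be the Farey word of slope [k/m] and [q] its length.  Consider the walk
    [i |-> i * k - m * (y 0 + ... + y (i - 1))], which is periodic.  If it varies
    by at most [m], then its values are forced except at multiples of [q],
    counted from a maximum, where there are two choices; recording these choices
    as a sequence [r] of period [gcd(m, k)], the orbit of [y] is the
    orbit of the image of [r] under [0 |-> u01, 1 |-> u10], which is what the
    operation [bullet] computes ([window_bsub], [bullet_farey]).  If it varies by
    more than [m], the orbit of [y] has a point below [0u0(1u0)...] and one
    above [1u1(0u1)...], hence on both sides of all the images just described
    ([window_upper], [window_lower]).  By induction on [m], every
    orbit has a smallest sequence at most, and a largest sequence at least,
    those of the orbit of some chain word ([domination]).

    On chains both extremal sequences increase strictly with the chain
    ([ext_slt]): for equal first entries [k] because the substitution is
    increasing, and for different ones because of the partial sums.  The chain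
    word becomes available just above the base where its largest sequence has
    value 1, and these bases increase with the chain ([cbase_slt]).  So for each
    [b] the best orbit is that of the largest chain whose base is below [b]
    ([tau_chain]).  This gives the formulas.  Values are continuous in the base,
    and at the base of a chain the function [tau] jumps up to the value of a
    strictly larger sequence, so the discontinuities are exactly the bases
    ([tau_discontinuities]).  Counting chains by their first entry gives the
    recursion of [psi] ([size_chain_enum]). *)

(** * Binary sequences *)

Notation binseq := (nat -> bool).

Definition shiftseq (n : nat) (y : binseq) : binseq := fun i => y (n + i).

Definition slt (y z : binseq) : Prop :=
  exists n, [/\ forall i, i < n -> y i = z i, y n = false & z n = true].

Definition sle (y z : binseq) : Prop := y = z \/ slt y z.

Definition psum (y : binseq) (n : nat) : nat := \sum_(i < n) y i.

Lemma first_diff (y z : binseq) : y <> z ->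
  exists n, (forall i, i < n -> y i = z i) /\ y n != z n.
Proof.
move=> yz; have [n yzn] : exists n, y n != z n.
  apply: contrapT => /forallNP yz0; apply: yz; apply/funext => i.
  by apply/eqP/negPn/negP => /yz0.
have exn : exists n, y n != z n by exists n.
case: (ex_minnP exn) => n0 yzn0 min0; exists n0; split=> // i ilt.
by apply/eqP/negPn/negP => /min0; rewrite leqNgt ilt.
Qed.

Lemma slt_irr y : ~ slt y y.
Proof. by case=> n [_ -> ]. Qed.

Lemma slt_trans : forall y x z, slt x y -> slt y z -> slt x z.
Proof.
move=> y x z [a [Ha xa ya]] [b [Hb yb zb]].
case: (ltngtP a b) => ab.
- exists a; split=> //; last by rewrite -Hb.
  by move=> i ia; rewrite Ha // Hb //; lia.
- exists b; split=> //; last by rewrite Ha.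
  by move=> i ia; rewrite Ha ?Hb //; lia.
- by move: ya; rewrite ab yb.
Qed.

Lemma slt_sle_trans y x z : slt x y -> sle y z -> slt x z.
Proof. by move=> xy [<-//|]; exact: slt_trans. Qed.

Lemma sle_slt_trans y x z : sle x y -> slt y z -> slt x z.
Proof. by move=> [->//|]; exact: slt_trans. Qed.

Lemma sle_trans y x z : sle x y -> sle y z -> sle x z.
Proof. by move=> [->//|xy yz]; right; exact: slt_sle_trans yz. Qed.

Lemma sltW y z : slt y z -> sle y z. Proof. by right. Qed.

Lemma sle_total y z : sle y z \/ slt z y.
Proof.
have [->|yz] := pselect (y = z); first by left; left.
have [n [H]] := first_diff yz.
case yn: (y n); case zn: (z n) => // _; last by left; right; exists n.
by right; exists n; split=> // i ilt; rewrite H.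
Qed.

Lemma sle_neq_slt y z : sle y z -> y <> z -> slt y z.
Proof. by case. Qed.

Lemma slt0 y z : y 0 = false -> z 0 = true -> slt y z.
Proof. by move=> y0 z0; exists 0. Qed.

Lemma sle_const0 y : sle (fun _ => false) y.
Proof.
have [->|yz] := pselect ((fun _ => false) = y); first by left.
have [n [H]] := first_diff yz.
by case E: (y n) => // _; right; exists n.
Qed.

Lemma sle_const1 y : sle y (fun _ => true).
Proof.
have [->|yz] := pselect (y = fun _ => true); first by left.
have [n [H]] := first_diff yz.
by case E: (y n) => // _; right; exists n.
Qed.

Lemma slt_compl y z : slt y z -> slt (fun i => ~~ z i) (fun i => ~~ y i).
Proof.
move=> [n [H yn zn]]; exists n; split; rewrite ?yn ?zn //.
by move=> i ilt; rewrite H.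
Qed.

Lemma sle_compl y z : sle y z -> sle (fun i => ~~ z i) (fun i => ~~ y i).
Proof. by move=> [->|/slt_compl]; [left|right]. Qed.

Lemma shiftseqD a b y : shiftseq a (shiftseq b y) = shiftseq (b + a) y.
Proof. by apply/funext => i; rewrite /shiftseq addnA. Qed.

Lemma shiftseq0 y : shiftseq 0 y = y.
Proof. exact/funext. Qed.

Lemma psum0 y : psum y 0 = 0.
Proof. by rewrite /psum big_ord0. Qed.

Lemma psumS y n : psum y n.+1 = psum y n + y n.
Proof. by rewrite /psum big_ord_recr. Qed.

Lemma psum_shiftseq n y j : psum (shiftseq n y) j + psum y n = psum y (n + j).
Proof.
elim: j => [|j IH]; first by rewrite psum0 addn0.
by rewrite addnS !psumS -IH /shiftseq addnAC.
Qed.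

Lemma eq_psum y z n : (forall i, i < n -> y i = z i) -> psum y n = psum z n.
Proof. by move=> H; apply: eq_bigr => i _; rewrite H. Qed.

Lemma psum_inj y z : (forall j, 0 < j -> psum y j = psum z j) -> y = z.
Proof.
move=> H; have {}H j : psum y j = psum z j.
  by case: j => [|j]; [rewrite !psum0|exact: H].
apply/funext => i; have := H i.+1; rewrite !psumS H.
by case: (y i); case: (z i) => //; lia.
Qed.

(** At the first index where two sequences differ their partial sums agree just
    before, so the smaller partial sum has the digit 0 there. *)
Lemma psum_sle y z : (forall j, 0 < j -> psum y j <= psum z j) -> sle y z.
Proof.
move=> H; have [->|yz] := pselect (y = z); first by left.
have [n [E yzn]] := first_diff yz; right; exists n; split=> //.
all: by have := H n.+1 isT; rewrite !psumS (eq_psum E) leq_add2l;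
        move: yzn; case: (y n); case: (z n).
Qed.

Definition mperiodic (m : nat) (y : binseq) : Prop := forall i, y (m + i) = y i.

Definition mprimitive (m : nat) (y : binseq) : Prop :=
  forall i, 0 < i < m -> shiftseq i y <> y.

Lemma periodic_shiftseq m y n : mperiodic m y -> mperiodic m (shiftseq n y).
Proof. by move=> py i; rewrite /shiftseq addnCA py. Qed.

Lemma periodicM m y n i : mperiodic m y -> y (n * m + i) = y i.
Proof.
by move=> py; elim: n => [|n IH]; rewrite ?mul0n // mulSn -addnA py.
Qed.

Lemma shiftseq_periodic m y n : mperiodic m y -> shiftseq (n * m) y = y.
Proof. by move=> py; apply/funext => i; rewrite /shiftseq periodicM. Qed.

Lemma periodic_mod m y i : mperiodic m y -> y (i %% m) = y i.
Proof. by move=> py; rewrite [in RHS](divn_eq i m) periodicM. Qed.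

Lemma shiftseq_mod m y i : mperiodic m y -> shiftseq (i %% m) y = shiftseq i y.
Proof.
move=> py; rewrite [in RHS](divn_eq i m) -shiftseqD shiftseq_periodic //.
Qed.

Lemma shiftseq_back m y n : 0 < m -> mperiodic m y ->
  exists n', shiftseq n' (shiftseq n y) = y.
Proof.
move=> m0 py; exists (n * m - n); rewrite shiftseqD subnKC ?shiftseq_periodic //.
by rewrite leq_pmulr.
Qed.

Lemma primitive_shiftseq m y n : 0 < m -> mperiodic m y -> mprimitive m y ->
  mprimitive m (shiftseq n y).
Proof.
move=> m0 py pr i im E; have [n' E'] := shiftseq_back n m0 py.
by apply: (pr i im); rewrite -{1}E' shiftseqD addnC -shiftseqD E.
Qed.

Lemma psum_periodic m y n j : mperiodic m y ->
  psum y (n * m + j) = n * psum y m + psum y j.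
Proof.
move=> py; elim: n => [|n IH]; first by rewrite !mul0n.
rewrite mulSn -addnA -psum_shiftseq.
have -> : shiftseq m y = y by apply/funext => i; exact: py.
by rewrite IH mulSn; lia.
Qed.

Lemma psum_compl y j : psum (fun i => ~~ y i) j + psum y j = j.
Proof.
elim: j => [|j IH]; first by rewrite !psum0.
by rewrite !psumS; case: (y j) => /=; lia.
Qed.

(** Stepping back over a 0 does not increase a sequence, so one may step back
    until a 1 is met. *)
Lemma step_back1 y z e j : e < j -> y e = true -> sle (shiftseq j y) z ->
  exists e', y e' = true /\ sle (shiftseq e'.+1 y) z.
Proof.
elim: j => // j IH ej ye Hz; case yj : (y j); first by exists j.
apply: IH => //; first by rewrite ltn_neqAle -ltnS ej andbT;
  apply/eqP => E; move: ye; rewrite E yj.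
apply: sle_trans Hz.
case: (sle_total (shiftseq j y) (shiftseq j.+1 y)) => // -[n [H H1 H2]].
have H0 : forall i, i <= n -> y (j + i) = false.
  elim=> [|i IHi] le; first by rewrite addn0.
  have := H i le; rewrite /shiftseq addSnnS => ->; rewrite IHi //; lia.
by move: H2; rewrite /shiftseq H0.
Qed.

Lemma step_back0 y z e j : e < j -> y e = false -> sle z (shiftseq j y) ->
  exists e', y e' = false /\ sle z (shiftseq e'.+1 y).
Proof.
move=> ej ye /sle_compl Hz.
have ye1 : ~~ y e = true by rewrite ye.
have [e' [ye' Hz']] := step_back1 (y := fun i => ~~ y i) ej ye1 Hz.
exists e'; split; first by case: (y e') ye'.
move/sle_compl: Hz'; congr sle; apply/funext => i; exact: negbK.
Qed.

(** * The substitution attached to a rational slope *)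

Definition den (m k : nat) : nat := m %/ gcdn m k.

(** The digits of the mechanical (Sturmian) sequence of slope [k/m]. *)
Definition mech (k m j : nat) : bool := j * k %/ m < j.+1 * k %/ m.

(** If [0u1] is the Farey word of slope [k/m] then [bsub m k x r] is the sequence
    [x u r0 ~r0 u r1 ~r1 u r2 ...]: the letter [x] followed by the image
    of [r] under the substitution [0 |-> u01, 1 |-> u10].  With a constant [r] it
    is [(0u1)(0u1)...] for [x = 0, r = 1...] and [(1u0)(1u0)...] for
    [x = 1, r = 0...]; the other two choices change the first letter of these. *)
Definition bsub (m k : nat) (x : bool) (r : binseq) : binseq := fun j =>
  if den m k %| j then (if j == 0 then x else ~~ r (j %/ den m k).-1)
  else if den m k %| j.+1 then r (j %/ den m k) else mech k m j.

(* For goals that are linear once each quotient is read as an unknown. *)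
Ltac lia_quot :=
  repeat match goal with |- context [?a %/ ?b] =>
    generalize (a %/ b); intro end; clear; lia.

Lemma divn_bounds a x m : a * m <= x -> x < a.+1 * m -> x %/ m = a.
Proof.
move=> h1 h2; have m0 : 0 < m by case: m h1 h2 => // _; rewrite muln0.
by apply/eqP; rewrite eqn_leq leq_divRL // h1 andbT -ltnS ltn_divLR.
Qed.

Lemma divD_bounds a b m : 0 < m ->
  a %/ m + b %/ m <= (a + b) %/ m <= (a %/ m + b %/ m).+1.
Proof.
move=> m0; apply/andP; split.
  by rewrite leq_divRL // mulnDl leq_add // leq_trunc_div.
rewrite -ltnS ltn_divLR //; have := ltn_ceil a m0; have := ltn_ceil b m0.
rewrite !mulSn mulnDl; lia.
Qed.

Lemma divD_dvd a b m : 0 < m -> m %| a + b -> ~~ (m %| a) ->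
  (a + b) %/ m = (a %/ m + b %/ m).+1.
Proof.
move=> m0 mab; rewrite dvdn_eq => ma.
apply: divn_bounds; last first.
  by rewrite -ltn_divLR // ltnS; case/andP: (divD_bounds a b m0).
have h1 : a %/ m * m < a by rewrite ltn_neqAle ma leq_trunc_div.
rewrite -leq_divRL // ltn_divRL // mulnDl -addSn leq_add //.
exact: leq_trunc_div.
Qed.

Lemma den_mul m k : den m k * gcdn m k = m.
Proof. by rewrite divnK // dvdn_gcdl. Qed.

Section Slope.
Variables (m k : nat).
Hypothesis km : 0 < k < m.
Let q := den m k.
Let d := gcdn m k.

Lemma gcd_gt0 : 0 < d.
Proof. by rewrite gcdn_gt0; case/andP: km => -> _; rewrite orbT. Qed.

Lemma gcd_lt : d < m.
Proof.
have /andP[k0 kltm] := km.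
exact: leq_ltn_trans (dvdn_leq k0 (dvdn_gcdr m k)) kltm.
Qed.

Lemma den_gt1 : 1 < q.
Proof.
have := den_mul m k; rewrite -/q -/d => E; have := gcd_lt; have := gcd_gt0.
by case: q E => [|[|//]]; lia.
Qed.

Lemma den_gt0 : 0 < q. Proof. exact: ltnW den_gt1. Qed.

Lemma den_dvd j : (q %| j) = (m %| j * k).
Proof.
have d0 := gcd_gt0.
have kE : k = k %/ d * d by rewrite divnK // dvdn_gcdr.
have -> : (m %| j * k) = (q * d %| j * (k %/ d) * d).
  by rewrite -mulnA -kE den_mul.
rewrite dvdn_pmul2r // Gauss_dvdl // /coprime -(eqn_pmul2r d0) mul1n.
by rewrite muln_gcdl -kE den_mul.
Qed.

Lemma den_dvdS j : q %| j -> q %| j.+1 = false.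
Proof.
move=> qj; rewrite -addn1 dvdn_addr // dvdn1; apply/negbTE/eqP => E.
by have := den_gt1; rewrite E.
Qed.

Lemma divS_notdvd j : ~~ (q %| j) -> j * k %/ m * m < j * k.
Proof.
move=> qj; rewrite ltn_neqAle leq_trunc_div andbT.
by rewrite -dvdn_eq -den_dvd.
Qed.

Lemma div_le_next j : j * k %/ m <= j.+1 * k %/ m <= (j * k %/ m).+1.
Proof.
have /andP[k0 kltm] := km; have m0 : 0 < m by lia.
rewrite leq_div2r /=; last by rewrite leq_mul2r leqnSn orbT.
rewrite -ltnS ltn_divLR // mulSn.
have := ltn_ceil (j * k) m0; rewrite !mulSn; lia.
Qed.

Lemma div_next_dvd j : q %| j -> j.+1 * k %/ m = j * k %/ m.
Proof.
rewrite den_dvd => mj; have /andP[k0 kltm] := km; have m0 : 0 < m by lia.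
apply: divn_bounds; rewrite ?mulSn divnK //; lia.
Qed.

Lemma div_prev_dvd j : q %| j.+1 -> j.+1 * k %/ m = (j * k %/ m).+1.
Proof.
rewrite den_dvd => mj; have /andP[k0 kltm] := km; have m0 : 0 < m by lia.
have /andP[h1 h2] := div_le_next j.
apply/eqP; rewrite eqn_leq h2 ltn_divLR // divnK // mulSn; lia.
Qed.

Lemma divSq j : q %| j.+1 -> j.+1 %/ q = (j %/ q).+1.
Proof.
move=> qj; apply: divn_bounds; last first.
  have := ltn_ceil j den_gt0; rewrite !mulSn; have := den_gt1; lia.
rewrite -[leqRHS](divnK qj) leq_pmul2r ?den_gt0 //.
by rewrite ltn_divLR ?den_gt0 // divnK.
Qed.

(** Each substituted block has the same number of ones whatever its letter, so
    [r] is visible in the partial sums only at multiples of the block length,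
    where exchanging [01] and [10] moves one unit by one place. *)
Lemma psum_bsub x r j : 0 < j ->
  psum (bsub m k x r) j + ((q %| j) && ~~ r (j %/ q).-1) = x + j * k %/ m.
Proof.
have q1 := den_gt1; have /andP[k0 kltm] := km.
case: j => // j _; elim: j => [|j IH].
  rewrite psumS psum0 /bsub -/q dvdn0 eqxx mul1n divn_small // dvdn1.
  by rewrite gtn_eqF // andFb !addn0 add0n divn_small ?addn0.
rewrite psumS {2}/bsub -/q.
have [qj|qj] := boolP (q %| j.+1).
  have qSj := den_dvdS qj; rewrite qSj /= div_next_dvd // -IH qj /=; lia.
rewrite (negbTE qj) /= addn0 in IH.
have [qSj|qSj] := boolP (q %| j.+2).
  rewrite (div_prev_dvd qSj) /= (divSq qSj) /= IH.
  by case: (r _) => /=; lia.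
rewrite /= addn0 IH /mech; have /andP[h1 h2] := div_le_next j.+1.
by case: ltnP => h3 /=; lia.
Qed.

Lemma psum_bsub_le x r j : psum (bsub m k x r) j <= x + j * k %/ m.
Proof.
case: j => [|j]; first by rewrite psum0.
by rewrite -(psum_bsub x r (ltn0Sn j)) leq_addr.
Qed.

Lemma psum_bsub_notdvd x r j : ~~ (q %| j) ->
  psum (bsub m k x r) j = x + j * k %/ m.
Proof.
move=> qj; rewrite -(psum_bsub x r) ?(negbTE qj) ?addn0 //.
by case: j qj => //; rewrite dvdn0.
Qed.

Lemma bsub_0 x r : bsub m k x r 0 = x.
Proof. by rewrite /bsub dvdn0. Qed.

Lemma bsub_block x r l : bsub m k x r (l.+1 * q).-1 = r l.
Proof.
have q1 := den_gt1.
have E : (l.+1 * q).-1 = l * q + q.-1 by rewrite mulSn; lia.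
rewrite /bsub -/q E dvdn_addr ?dvdn_mull // gtnNdvd //; try lia.
have -> : (l * q + q.-1).+1 = l.+1 * q by rewrite mulSn; lia.
rewrite dvdn_mull // divnMDl ?den_gt0 // divn_small ?addn0 //; lia.
Qed.

(** The letter before a block is the complement of the preceding letter of [r],
    so shifting by whole blocks stays within the same family. *)
Lemma shiftseq_bsub x r l :
  shiftseq (l.+1 * q) (bsub m k x r) = bsub m k (~~ r l) (shiftseq l.+1 r).
Proof.
have q1 := den_gt1; have q0 := den_gt0.
apply/funext => j; rewrite /shiftseq /bsub -/q.
rewrite dvdn_addr ?dvdn_mull // -addnS dvdn_addr ?dvdn_mull //.
have -> : (l.+1 * q + j == 0) = false by rewrite mulSn; lia.
rewrite divnMDl // /mech.
have [qj|qj] := boolP (q %| j).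
  case: eqP => [->|/eqP j0]; first by rewrite div0n addn0.
  have j0' : 0 < j %/ q by rewrite divn_gt0 // dvdn_leq // lt0n.
  by congr (~~ r _); lia.
case: ifP => // _.
have mq : m %| l.+1 * q * k by rewrite -den_dvd dvdn_mull.
rewrite -addnS; move: (l.+1 * q) mq => a mq.
by rewrite (mulnDl a j) (mulnDl a j.+1) (divnDl (j * k) mq)
  (divnDl (j.+1 * k) mq) ltn_add2l.
Qed.

Lemma bsub_slt x r r' : slt r r' -> slt (bsub m k x r) (bsub m k x r').
Proof.
have q1 := den_gt1; have q0 := den_gt0.
move=> [n [E rn rn']]; exists (n.+1 * q).-1; rewrite !bsub_block; split=> // i.
have i1 : (n.+1 * q).-1 < n.+1 * q by rewrite mulSn; lia.
move=> ilt; rewrite /bsub -/q.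
have idq : i %/ q <= n by rewrite -ltnS ltn_divLR //; lia.
case: ifP => [qi|qi].
  case: eqP => // /eqP i0; rewrite E //.
  have : 0 < i %/ q by rewrite divn_gt0 // dvdn_leq //; lia.
  lia.
case: ifP => // qSi; rewrite E //.
have := divSq qSi; have := divnK qSi; move=> E1 E2; rewrite E2 in E1.
have : i.+1 < n.+1 * q by lia.
by rewrite -E1 ltn_pmul2r.
Qed.

Lemma bsub_sle x r r' : sle r r' -> sle (bsub m k x r) (bsub m k x r').
Proof. by move=> [->|/(bsub_slt x)]; [left|right]. Qed.

Lemma bsub_slt01 r r' : slt (bsub m k false r) (bsub m k true r').
Proof. by apply: slt0; rewrite bsub_0. Qed.

(** Shifts that do not start at a block boundary see digits of slope [k/m] up
    to an error that keeps their partial sums between floor and ceiling. *)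
Lemma bsub_mid x r j : ~~ (q %| j) ->
  sle (bsub m k false (fun _ => true)) (shiftseq j (bsub m k x r)) /\
  sle (shiftseq j (bsub m k x r)) (bsub m k true (fun _ => false)).
Proof.
have m0 : 0 < m by have /andP[] := km; lia.
move=> qj; have Pj := psum_bsub_notdvd x r qj.
have j0 : 0 < j by case: j qj {Pj} => //; rewrite dvdn0.
split; apply: psum_sle => i i0.
  apply: leq_trans (psum_bsub_le _ _ _) _.
  rewrite -(leq_add2r (psum (bsub m k x r) j)) psum_shiftseq Pj.
  have := psum_bsub x r (ltn_addr i j0).
  have := divD_bounds (j * k) (i * k) m0; rewrite -mulnDl.
  have [qji|qji] := boolP (q %| j + i); last by rewrite andFb; lia_quot.
  have E : (j * k + i * k) %/ m = (j * k %/ m + i * k %/ m).+1.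
    by apply: divD_dvd => //; rewrite -?mulnDl -den_dvd.
  by rewrite mulnDl E; case: (r _) => /=; lia_quot.
rewrite -(leq_add2r (psum (bsub m k x r) j)) psum_shiftseq Pj.
apply: leq_trans (psum_bsub_le _ _ _) _.
have := psum_bsub true (fun=> false) i0; rewrite andbT.
have := divD_bounds (j * k) (i * k) m0; rewrite -mulnDl.
have [qi|qi] := boolP (q %| i); last by rewrite addn0; lia_quot.
by rewrite mulnDl divnDr -?den_dvd //=; lia_quot.
Qed.
End Slope.

(** * Chains and the extremal sequences of their orbits *)

(** A chain is represented here by the list [ks] of its entries after [m], and
    the remaining entries of [k :: ks] form a chain for [gcdn m k]. *)
Fixpoint adm (m : nat) (ks : seq nat) : bool :=
  if ks is k :: ks' then (0 < k < m) && adm (gcdn m k) ks' else m == 1.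

Fixpoint clt (ks ks' : seq nat) : bool :=
  match ks, ks' with
  | k :: t, k' :: t' => (k < k') || (k == k') && clt t t'
  | _, _ => false
  end.

(** The smallest ([x = false]) and the largest ([x = true]) sequence of the orbit
    of a chain word.  The value at the empty chain is not the orbit of a word: it
    is chosen so that the one-entry chains, which have [gcdn m k = 1], yield
    [(0u1)(0u1)...] and [(1u0)(1u0)...]. *)
Fixpoint ext (x : bool) (m : nat) (ks : seq nat) : binseq :=
  if ks is k :: ks' then bsub m k x (ext x (gcdn m k) ks')
  else fun _ => ~~ x.

Lemma adm1 ks : adm 1 ks -> ks = [::].
Proof. by case: ks => // -[|k] ks /=. Qed.

Lemma clt_total m ks ks' : adm m ks -> adm m ks' ->
  [\/ ks = ks', clt ks ks' | clt ks' ks].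
Proof.
elim: ks m ks' => [|k ks IH] m [|k' ks'].
- by move=> _ _; constructor 1.
- by move=> /eqP -> /adm1.
- by move=> /[swap] /eqP -> /adm1.
move=> /= /andP[_ a] /andP[_ a']; case: (ltngtP k k') => kk.
- by constructor 2.
- by constructor 3.
move: a'; rewrite -kk => a'; case: (IH _ _ a a') => [->|h|h].
- by constructor 1.
- by constructor 2.
- by constructor 3.
Qed.

(** The partial sums of [bsub m k x r] are at most [x + floor(j * k / m)] and at
    least [x - 1 + ceil(j * k / m)], and [floor(j * k / m) < j * k' / m]. *)
Lemma bsub_slope_slt m k k' x r r' : 0 < k < m -> 0 < k' < m -> k < k' ->
  slt (bsub m k x r) (bsub m k' x r').
Proof.
move=> km km' kk.
have m0 : 0 < m by have /andP[] := km; lia.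
have kltm : k' < m by case/andP: km'.
apply: sle_neq_slt.
  apply: psum_sle => j j0; apply: leq_trans (psum_bsub_le km _ _ _) _.
  have := psum_bsub km' x r' j0.
  have h1 : j * k %/ m <= j * k' %/ m by rewrite leq_div2r // leq_mul2l ltnW ?orbT.
  have [qj|qj] := boolP (den m k' %| j); last by rewrite andFb; move: h1; lia_quot.
  rewrite den_dvd // in qj.
  have h2 : j * k %/ m < j * k' %/ m.
    by rewrite ltn_divLR // divnK // ltn_mul2l j0.
  by move: h2; case: (r' _) => /=; lia_quot.
move=> /(congr1 (fun y => psum y m.+1)) E.
(* The sums of the first [m + 1] digits are [x + k] and [x + k'], so they differ. *)
have F a : a < m -> m.+1 * a %/ m = a.
  by move=> am; apply: divn_bounds; rewrite mulSn mulnC ?leq_addl // mulSn ltn_add2r.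
have := psum_bsub_le km x r m.+1; rewrite E psum_bsub_notdvd //.
  by rewrite !F //; lia.
by rewrite den_dvdS // den_dvd // dvdn_mulr.
Qed.

Lemma ext_slt x m ks ks' : adm m ks -> adm m ks' -> clt ks ks' ->
  slt (ext x m ks) (ext x m ks').
Proof.
elim: ks m ks' => [|k ks IH] m [|k' ks'] //=.
move=> /andP[km a] /andP[km' a'] /orP[kk|/andP[/eqP kk c]].
  exact: bsub_slope_slt.
by rewrite -kk in a' *; apply: bsub_slt => //; exact: IH.
Qed.

Lemma ext_last x m ks : adm m ks -> ext x m ks m.-1 = ~~ x.
Proof.
elim: ks m => [|k ks IH] m //= /andP[km a].
have -> : m.-1 = ((gcdn m k).-1.+1 * den m k).-1.
  by rewrite prednK ?gcd_gt0 // mulnC den_mul.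
by rewrite bsub_block // IH.
Qed.

(** After a full period the letter before the block is the complement of the last
    letter of the period of [r]; the hypothesis makes it the initial [x]. *)
Lemma bsub_periodic m k x r : 0 < k < m -> mperiodic (gcdn m k) r ->
  r (gcdn m k).-1 = ~~ x -> mperiodic m (bsub m k x r).
Proof.
move=> km pr rl i.
have := shiftseq_bsub km x r (gcdn m k).-1; rewrite prednK ?gcd_gt0 //.
rewrite mulnC den_mul => /(congr1 (fun y => y i)).
rewrite /shiftseq => ->; rewrite rl negbK; congr (bsub _ _ _ _ _).
by apply/funext => j; exact: pr.
Qed.

Lemma ext_periodic x m ks : adm m ks -> mperiodic m (ext x m ks).
Proof.
elim: ks m => [|k ks IH] m //= /andP[km a].
by apply: bsub_periodic => //; [exact: IH|exact: ext_last].
Qed.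

Lemma psum_bsub_full m k x r : 0 < k < m -> r (gcdn m k).-1 = ~~ x ->
  psum (bsub m k x r) m = k.
Proof.
move=> km rl; have m0 : 0 < m by have /andP[] := km; lia.
have := psum_bsub km x r m0.
have -> : m %/ den m k = gcdn m k.
  by rewrite -{1}(den_mul m k) mulKn // den_gt0.
rewrite den_dvd // dvdn_mulr // rl negbK andTb mulKn //; lia.
Qed.

(** A shift by a number that is not a multiple of the block length moves a
    sequence of slope [k/m], because a period [i] makes [i * k] divisible by [m]. *)
Lemma bsub_shiftseq_neq m k x r i : 0 < k < m -> mperiodic (gcdn m k) r ->
  r (gcdn m k).-1 = ~~ x -> ~~ (den m k %| i) ->
  shiftseq i (bsub m k x r) <> bsub m k x r.
Proof.
move=> km pr rl qi E; have py := bsub_periodic km pr rl.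
have pi : mperiodic i (bsub m k x r).
  by move=> j; rewrite -{2}E.
have h1 := psum_periodic i 0 py; have h2 := psum_periodic m 0 pi.
move: qi; rewrite den_dvd //; case/negP; apply/dvdnP.
exists (psum (bsub m k x r) i); move: h1; rewrite mulnC h2 psum0 !addn0.
by rewrite (psum_bsub_full km rl) => <-; rewrite mulnC.
Qed.

(** At block boundaries the comparison is that of the shorter sequence.  Every
    other shift lies above [(0u1)(0u1)...], hence above the smallest sequence. *)
Lemma ext_lyndon m ks i : adm m ks -> 0 < i < m ->
  slt (ext false m ks) (shiftseq i (ext false m ks)).
Proof.
elim: ks m i => [|k ks IH] m i; first by move=> /eqP ->; case: i => [|[]].
move=> /= /andP[km a] /andP[i0 im].
have [qi|qi] := boolP (den m k %| i); last first.
  apply: sle_neq_slt.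
    apply: sle_trans (proj1 (bsub_mid km _ _ qi)).
    by apply: bsub_sle => //; exact: sle_const1.
  move/esym; apply: bsub_shiftseq_neq => //; first exact: ext_periodic.
  exact: ext_last.
case/dvdnP: qi i0 im => -[|l] ->; first by rewrite mul0n.
move=> _ im; rewrite shiftseq_bsub //.
case: (ext _ _ _ l); last exact: bsub_slt01.
apply: bsub_slt => //; apply: IH => //.
by move: im; rewrite -{2}(den_mul m k) mulnC ltn_pmul2l ?den_gt0.
Qed.

(** Among the shifts of a sequence of blocks, those that do not start at a block
    boundary lie below [(1u0)(1u0)...], the least sequence of blocks beginning
    with 1. *)
Lemma bsub_max m k r h n : 0 < k < m ->
  (forall l, r l = false -> sle (shiftseq l.+1 r) h) ->
  sle (shiftseq n (bsub m k false r)) (bsub m k true h).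
Proof.
move=> km rh; have [qn|qn] := boolP (den m k %| n); last first.
  apply: sle_trans (proj2 (bsub_mid km _ _ qn)) _.
  by apply: bsub_sle => //; exact: sle_const0.
case/dvdnP: qn => -[|l] -> {n}.
  by rewrite mul0n shiftseq0; right; exact: bsub_slt01.
rewrite shiftseq_bsub //; case E : (r l); first by right; exact: bsub_slt01.
by apply: bsub_sle => //; exact: rh.
Qed.

Lemma ext_max m k ks n : adm m (k :: ks) ->
  sle (shiftseq n (ext false m (k :: ks))) (ext true m (k :: ks)).
Proof.
elim: ks m k n => [|k' ks IH] m k n /= /andP[km a]; apply: bsub_max => //= l.
by move=> _; exact: IH.
Qed.

Lemma ext_head x m k ks : ext x m (k :: ks) 0 = x.
Proof. exact: bsub_0. Qed.

(** For coprime slopes the largest shift of the floor sequence starts where the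
    multiples of [k] are congruent to -1 modulo [m]. *)
Lemma mech_top m k : 0 < k < m -> gcdn m k = 1 ->
  exists e, bsub m k false (fun _ => true) e = false /\
    shiftseq e.+1 (bsub m k false (fun _ => true)) =
    bsub m k true (fun _ => false).
Proof.
move=> km co; have /andP[k0 kltm] := km; have m0 : 0 < m by lia.
have P n : psum (bsub m k false (fun _ => true)) n = n * k %/ m.
  case: n => [|n]; first by rewrite psum0 div0n.
  by have := psum_bsub km false (fun _ => true) (ltn0Sn n); rewrite andbF addn0 => ->.
have [e [c Ec]] : exists e c, e.+1 * k = c * m + m.-1.
  have [a b E _] := egcdnP m k0; rewrite gcdnC co in E.
  have a0 : 0 < a by case: a E => // /esym; lia.
  exists (a * m.-1).-1, (b * m.-1); rewrite prednK; last by rewrite muln_gt0 a0; lia.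
  by rewrite mulnAC E mulnDl mul1n mulnAC.
have ecm : e.+1 * k %/ m = c by rewrite Ec divnMDl // divn_small ?addn0 //; lia.
exists e; split.
  have := psumS (bsub m k false (fun _ => true)) e; rewrite !P ecm.
  have -> : e * k %/ m = c.
    by move: Ec; rewrite mulSn => Ec; apply: divn_bounds; rewrite ?mulSn; lia.
  by case: (bsub _ _ _ _ _) => //=; lia.
apply: psum_inj => j j0; apply/eqP.
rewrite -(eqn_add2r (psum (bsub m k false (fun _ => true)) e.+1)).
rewrite psum_shiftseq !P mulnDl ecm Ec -addnA divnMDl // addnC eqn_add2r.
have := psum_bsub km true (fun _ => false) j0; rewrite andbT.
have [qj|qj] := boolP (den m k %| j); rewrite ?addn0.
  rewrite den_dvd // in qj; rewrite divnDr // (divn_small (m := m.-1)); last by lia.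
  by move=> /= E; apply/eqP; move: E; lia_quot.
move=> ->; apply/eqP; have h := divS_notdvd km qj.
have h' := ltn_ceil (j * k) m0.
by apply: divn_bounds; rewrite ?mulSn /=; move: h h'; rewrite ?mulSn /=; lia.
Qed.

Lemma ext_orbit m k ks : adm m (k :: ks) ->
  exists e, ext false m (k :: ks) e = false /\
    shiftseq e.+1 (ext false m (k :: ks)) = ext true m (k :: ks).
Proof.
elim: ks m k => [|k' ks IH] m k /andP[km a].
  by move/eqP: a => /(mech_top km).
have [e [e0 E]] := IH _ _ a; exists (e.+1 * den m k).-1.
have F x : ext x m [:: k, k' & ks]
         = bsub m k x (ext x (gcdn m k) (k' :: ks)) by [].
rewrite !F bsub_block // e0; split=> //.
by rewrite prednK ?muln_gt0 ?den_gt0 // shiftseq_bsub // e0 E.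
Qed.

(** * Every primitive orbit is dominated by the orbit of a chain *)

(** The walk [i |-> i * k - m * psum y i] varies by at most [m]. *)
Definition window (m k : nat) (y : binseq) : Prop :=
  forall i j, i * k + m * psum y j <= m + j * k + m * psum y i.

Lemma exists_peak m y : 0 < m -> mperiodic m y ->
  exists i0, forall j, j * psum y m <= m * psum (shiftseq i0 y) j.
Proof.
case: m => // m _ py; set k := psum y m.+1.
pose g (i : 'I_m.+1) := i * k + m.+1 * (m.+1 - psum y i).
have [i0 _ gmax] := @arg_maxnP _ (ord0 : 'I_m.+1) xpredT g isT.
have psum_lt (i : nat) : i < m.+1 -> psum y i <= m.+1.
  by move=> im; have := psum_compl y i; lia.
have H i : i * k + m.+1 * psum y i0 <= i0 * k + m.+1 * psum y i.
  have im : i %% m.+1 < m.+1 by rewrite ltn_mod.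
  have := gmax (Ordinal im) isT; rewrite /g /=.
  have /= h1 := psum_lt _ im; have h2 := psum_lt _ (ltn_ord i0).
  rewrite !mulnBr.
  have h3 : m.+1 * psum y (i %% m.+1) <= m.+1 * m.+1 by rewrite leq_mul2l h1 orbT.
  have h4 : m.+1 * psum y i0 <= m.+1 * m.+1 by rewrite leq_mul2l h2 orbT.
  rewrite {3 4}(divn_eq i m.+1) psum_periodic // -/k.
  move: (i %/ _) (i %% _) (psum y (i %% _)) h1 h3 => a r s h1 h3.
  rewrite mulnDl mulnDr mulnA (mulnAC a) (mulnC m.+1 a).
  by move: h3 h4; clear; lia.
exists i0 => j; have := H (i0 + j).
rewrite -psum_shiftseq mulnDl mulnDr; lia.
Qed.

Lemma mperiodic_compl m y : mperiodic m y -> mperiodic m (fun i => ~~ y i).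
Proof. by move=> py i; rewrite py. Qed.

Lemma exists_valley m y : 0 < m -> mperiodic m y ->
  exists i0, forall j, m * psum (shiftseq i0 y) j <= j * psum y m.
Proof.
move=> m0 /mperiodic_compl py; have [i0 H] := exists_peak m0 py.
exists i0 => j; have := H j.
have h1 := psum_compl (shiftseq i0 y) j; have h2 := psum_compl y m.
rewrite /shiftseq in h1 *.
set a := psum _ j in h1 *; set b := psum _ j in h1 *.
set u := psum _ m in h2 *; set v := psum _ m in h2 *.
move: h1 h2; clear => <- <-; nia.
Qed.

(** Start where the walk [i * k - m * psum y i] is maximal.  While a shift of [y]
    agrees with the sequence of partial sums [1 + floor (j * k / m)], the walk
    stays within [m] of its maximum; when it first drops below that sequence,
    the walk is back at its maximum. *)
Lemma window_upper m k y : 0 < k < m -> mperiodic m y -> psum y m = k ->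
  (forall i, sle (shiftseq i y) (bsub m k true (fun _ => true))) ->
  window m k y.
Proof.
move=> km py yk Hy; have m0 : 0 < m by have /andP[] := km; lia.
have [i0 N] := exists_peak m0 py; rewrite yk in N.
pose z := shiftseq i0 y.
have Hz i : sle (shiftseq i z) (bsub m k true (fun _ => true)).
  by rewrite shiftseqD.
have claim n i : m * psum z i = i * k -> m * psum z (i + n) <= (i + n) * k + m.
  elim/ltn_ind: n i => n IH i zi.
  have ok : psum (shiftseq i z) n <= 1 + n * k %/ m ->
            m * psum z (i + n) <= (i + n) * k + m.
    rewrite -(leq_pmul2l m0) mulnDr muln1 -psum_shiftseq mulnDr mulnDl zi.
    have := leq_trunc_div (n * k) m; rewrite mulnC.
    by move: (m * _) (m * _) => a b; lia.
  case: (Hz i) => [E|[j [E z1 b1]]].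
    by apply: ok; rewrite E; exact: psum_bsub_le.
  have [nj|jn] := leqP n j.
    apply: ok; rewrite (@eq_psum _ (bsub m k true (fun _ => true))).
      exact: psum_bsub_le.
    by move=> l ln; apply: E; lia.
  have h1 : psum (shiftseq i z) j.+1 <= j.+1 * k %/ m.
    have := psum_bsub_le km true (fun _ => true) j.+1.
    rewrite psumS b1 psumS z1 (eq_psum E) /=.
    by lia_quot.
  have h2 : m * psum z (i + j.+1) = (i + j.+1) * k.
    apply/eqP; rewrite eqn_leq N andbT.
    rewrite -psum_shiftseq mulnDr mulnDl zi addnC leq_add2l mulnC.
    by rewrite -leq_divRL.
  have -> : i + n = (i + j.+1) + (n - j.+1) by lia.
  by apply: IH => //; lia.
move=> i j; have le0 l : i0 <= m * i0 + l.
  by apply: leq_trans (leq_addr _ _); rewrite leq_pmull.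
have A l : m * psum z (m * i0 + l - i0) + m * psum y i0
           = m * (i0 * k) + m * psum y l.
  rewrite -!mulnDr; congr (m * _).
  by rewrite psum_shiftseq subnKC // (mulnC m i0) psum_periodic // yk.
have := claim (m * i0 + j - i0) 0.
rewrite psum0 muln0 mul0n => /(_ erefl); rewrite add0n.
have := N (m * i0 + i - i0); rewrite -/z; have := A i; have := A j.
have h1 := leq_mul (le0 i) (leqnn k); have h2 := leq_mul (le0 j) (leqnn k).
rewrite !mulnBl; move: h1 h2; rewrite !mulnDl.
by clear; nia.
Qed.

Lemma bsub_compl m k : 0 < k < m ->
  (fun i => ~~ bsub m k false (fun _ => false) i)
  = bsub m (m - k) true (fun _ => true).
Proof.
move=> km; have m0 : 0 < m by have /andP[] := km; lia.
have km' : 0 < m - k < m by lia.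
apply: psum_inj => j j0.
have h1 := psum_compl (bsub m k false (fun _ => false)) j.
have h2 := psum_bsub km false (fun _ => false) j0.
have := psum_bsub km' true (fun _ => true) j0.
rewrite andbF addn0 => ->; rewrite andbT den_dvd // in h2.
have Em : j * k + j * (m - k) = j * m by rewrite -mulnDr subnKC //; lia.
have [d|nd] := boolP (m %| j * k); rewrite ?d ?(negbTE nd) in h2.
  have : (j * k + j * (m - k)) %/ m = j by rewrite Em mulnK.
  rewrite divnDl //; move: h1 h2 => /=.
  by move: (psum _ _) (psum _ _) => a b; lia_quot.
have : (j * k + j * (m - k)) %/ m = j by rewrite Em mulnK.
rewrite divD_dvd // ?Em ?dvdn_mull //; move: h1 h2 => /=.
by move: (psum _ _) (psum _ _) => a b; lia_quot.
Qed.

(** Exchanging 0 and 1 reverses the order, turns the slope [k/m] into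
    [(m - k)/m] and changes the sign of the walk. *)
Lemma window_lower m k y : 0 < k < m -> mperiodic m y -> psum y m = k ->
  (forall i, sle (bsub m k false (fun _ => false)) (shiftseq i y)) ->
  window m k y.
Proof.
move=> km py yk Hy; have km' : 0 < m - k < m by lia.
have W : window m (m - k) (fun i => ~~ y i).
  apply: window_upper => //; first exact: mperiodic_compl.
    by have := psum_compl y m; rewrite yk; lia.
  by move=> i; rewrite -bsub_compl //; apply: (sle_compl (Hy i)).
move=> i j; have := W j i.
have := psum_compl y i; have := psum_compl y j.
move: (psum (fun i => ~~ _) _) (psum (fun i => ~~ _) _) => a b.
move: (psum y i) (psum y j) => c e; case/andP: km; clear => k0 /ltnW km.
rewrite !mulnBr => <- <-; have : (a + e) * k <= (a + e) * m by rewrite leq_mul2l km orbT.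
have : (b + c) * k <= (b + c) * m by rewrite leq_mul2l km orbT.
nia.
Qed.

(** The walk is congruent to [i * k] modulo [m]; since it stays in an interval of
    length [m] ending at its initial value 0, it is determined except where [m]
    divides [i * k].  These are the multiples of the block length, and [r]
    records which end of the interval is attained there. *)
Lemma window_bsub m k y : 0 < k < m -> window m k y ->
  (forall j, j * k <= m * psum y j) -> exists r, y = bsub m k true r.
Proof.
move=> km W N; have m0 : 0 < m by have /andP[] := km; lia.
exists (fun l => psum y (l.+1 * den m k) == (l.+1 * den m k * k %/ m).+1).
apply: psum_inj => j j0; set r := fun l => _.
have := psum_bsub km true r j0.
have h1 : j * k %/ m <= psum y j <= (j * k %/ m).+1.
  apply/andP; split; first by have := leq_div2r m (N j); rewrite mulKn.
  have := W 0 j; rewrite mul0n psum0 muln0 add0n addn0 => /(leq_div2r m).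
  by rewrite mulKn // divnDl // divnn m0.
have [/dvdnP[[|l] jE]|qj] := boolP (den m k %| j).
- by rewrite jE in j0.
- rewrite jE mulnK ?den_gt0 //= => H; move: h1; rewrite jE => h1.
  move: H; rewrite /r; case: eqP => E /=; first by rewrite E; lia_quot.
  by move: h1 E; lia_quot.
rewrite addn0 => ->; rewrite den_dvd // in qj.
apply/eqP; rewrite eqn_leq; case/andP: h1 => _ -> /=.
rewrite add1n ltn_divLR // ltn_neqAle [psum y j * m]mulnC N andbT.
by apply: contraNneq qj => ->; rewrite dvdn_mulr.
Qed.

Lemma both_digits m y b : 1 < m -> mprimitive m y -> exists i, y i = b.
Proof.
move=> m1 pr; apply: contrapT => /forallNP H; apply: (pr 1); first by rewrite m1.
apply/funext => i; rewrite /shiftseq.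
by move: (H i) (H (1 + i)); case: (y i); case: (y (1 + i)); case: b {H}.
Qed.

Lemma after1 m y z e : 1 < m -> mperiodic m y -> mprimitive m y ->
  sle (shiftseq e y) z -> exists e', y e' = true /\ sle (shiftseq e'.+1 y) z.
Proof.
move=> m1 py pr H; have [i yi] := both_digits true m1 pr.
apply: (@step_back1 _ _ i (i.+1 * m + e)) => //; first by nia.
by rewrite -shiftseqD shiftseq_periodic.
Qed.

Lemma after0 m y z e : 1 < m -> mperiodic m y -> mprimitive m y ->
  sle z (shiftseq e y) -> exists e', y e' = false /\ sle z (shiftseq e'.+1 y).
Proof.
move=> m1 py pr H; have [i yi] := both_digits false m1 pr.
apply: (@step_back0 _ _ i (i.+1 * m + e)) => //; first by nia.
by rewrite -shiftseqD shiftseq_periodic.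
Qed.

(** The lexicographic interval spanned by the orbit of [y] contains the orbit of
    the chain. *)
Definition dominated (m : nat) (y : binseq) (ks : seq nat) : Prop :=
  (exists e, sle (shiftseq e y) (ext false m ks)) /\
  (exists e, sle (ext true m ks) (shiftseq e y)).

Lemma psum_interior m y : 1 < m -> mperiodic m y -> mprimitive m y ->
  0 < psum y m < m.
Proof.
move=> m1 py pr; have m0 := ltnW m1.
have const b : (forall i, i < m -> y i = b) -> False.
  move=> H; apply: (pr 1); first by rewrite m1.
  apply/funext => i; rewrite /shiftseq -(periodic_mod _ py) -[RHS](periodic_mod _ py).
  by rewrite !H // ltn_mod.
have pos (w : binseq) i : i < m -> w i = true -> 0 < psum w m.
  move=> im wi; rewrite /psum (bigD1 (Ordinal im)) //= wi; lia.
apply/andP; split.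
  rewrite lt0n; apply/negP => /eqP E; apply: (const false) => i im.
  by case yi : (y i) => //; have := pos y i im yi; rewrite E.
have := psum_compl y m; suff : 0 < psum (fun i => ~~ y i) m by lia.
rewrite lt0n; apply/negP => /eqP E; apply: (const true) => i im.
by case yi : (y i) => //; have := pos (fun i => ~~ y i) i im; rewrite yi E => /(_ erefl).
Qed.

Lemma bsub_inj m k x x' r r' : 0 < k < m ->
  bsub m k x r = bsub m k x' r' -> r = r'.
Proof.
move=> km /(congr1 (fun y l => y (l.+1 * den m k).-1)) E.
apply/funext => l; have := congr1 (fun f => f l) E.
by rewrite /= !bsub_block.
Qed.

(** A shorter period of [r] would give the block boundaries the same letters, so
    a shorter period of the whole sequence. *)
Lemma bsub_primitive m k r : 0 < k < m -> mperiodic m (bsub m k true r) ->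
  mprimitive m (bsub m k true r) ->
  [/\ mperiodic (gcdn m k) r, mprimitive (gcdn m k) r & r (gcdn m k).-1 = false].
Proof.
move=> km py pr; have d0 := gcd_gt0 km; have q0 := den_gt0 km.
have mE : (gcdn m k).-1.+1 * den m k = m by rewrite prednK // mulnC den_mul.
have E : shiftseq m (bsub m k true r) = bsub m k true r by apply/funext.
have rl : r (gcdn m k).-1 = false.
  have := congr1 (fun y => y 0) E; rewrite -{1}mE shiftseq_bsub // !bsub_0.
  by case: (r _).
have pd : mperiodic (gcdn m k) r.
  move: E; rewrite -{1}mE shiftseq_bsub // => /bsub_inj -/(_ km) E i.
  by rewrite -{2}E prednK.
split=> // -[|i] // /andP[_ id] Er.
have ri : r i = false.
  have pi : mperiodic i.+1 r by move=> j; rewrite -{2}Er.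
  rewrite -rl -(periodicM (gcdn m k).-1 i pi) -[in RHS](periodicM i (gcdn m k).-1 pd).
  by congr r; nia.
apply: (pr (i.+1 * den m k)).
  by rewrite muln_gt0 q0 /= -{2}mE ltn_pmul2r // prednK.
by rewrite shiftseq_bsub // Er ri.
Qed.

Lemma not_window m k y : 0 < k < m -> mperiodic m y -> psum y m = k ->
  ~ window m k y ->
  (exists e, sle (shiftseq e y) (bsub m k false (fun _ => false))) /\
  (exists e, sle (bsub m k true (fun _ => true)) (shiftseq e y)).
Proof.
move=> km py yk nW; split.
  apply: contrapT => /forallNP H; apply: nW; apply: window_lower => // i.
  by case: (sle_total (shiftseq i y) (bsub m k false (fun _ => false))) => [/H|/sltW].
apply: contrapT => /forallNP H; apply: nW; apply: window_upper => // i.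
by case: (sle_total (bsub m k true (fun _ => true)) (shiftseq i y)) => [/H|/sltW].
Qed.

Lemma adm_exists m : 0 < m -> exists ks, adm m ks.
Proof.
case: m => [|[|m]] // _; first by exists [::].
by exists [:: 1]; rewrite /= gcdn1.
Qed.

(** For coprime [k] and [m] the sequences that start at a maximum and at a minimum
    of the walk do it.  Otherwise either the walk stays in a window and
    the orbit comes from one of period [gcdn m k], or both bounds hold for every
    chain that starts with [k]. *)
Lemma domination m y : 0 < m -> mperiodic m y -> mprimitive m y ->
  exists ks, adm m ks /\ dominated m y ks.
Proof.
elim/ltn_ind: m y => m IH y0 m0 py0 pr0.
have [m1|m1] := leqP m 1.
  have -> : m = 1 by lia.
  exists [::]; split=> //; split; exists 0; [exact: sle_const1|exact: sle_const0].
have [i0] := exists_peak m0 py0.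
have py := periodic_shiftseq i0 py0; have pr := primitive_shiftseq (n := i0) m0 py0 pr0.
have km := psum_interior m1 py pr.
have -> : psum y0 m = psum (shiftseq i0 y0) m.
  have := psum_periodic 1 i0 py0.
  by rewrite !mul1n (addnC m) -psum_shiftseq => /addIn.
suff dom : forall y, mperiodic m y -> mprimitive m y -> 0 < psum y m < m ->
    (forall j, j * psum y m <= m * psum y j) ->
    exists ks, adm m ks /\ dominated m y ks.
  move=> N; have [ks [a [[e1 H1] [e2 H2]]]] := dom _ py pr km N.
  by exists ks; split=> //; split; [exists (i0 + e1)|exists (i0 + e2)];
    rewrite -shiftseqD.
move=> {y0 i0 py0 pr0 py pr km} y py pr km N; set k := psum y m in km N *.
have d0 := gcd_gt0 km; have dm := gcd_lt km.
have [d1|d1] := eqVneq (gcdn m k) 1.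
  exists [:: k]; rewrite /= d1 km; split=> //; split.
    have [i1 V] := exists_valley m0 py; exists i1; apply: psum_sle => j j0.
    have := psum_bsub km false (fun _ => true) j0; rewrite /= andbF addn0 => ->.
    by have := leq_div2r m (V j); rewrite mulKn.
  exists 0; rewrite shiftseq0; apply: psum_sle => j j0.
  have := psum_bsub km true (fun _ => false) j0; rewrite /= andbT.
  have := leq_div2r m (N j); rewrite mulKn //.
  have [qj|qj] := boolP (den m k %| j); first by rewrite /=; lia_quot.
  rewrite addn0 => h ->; rewrite den_dvd // in qj.
  rewrite add1n ltn_divLR // ltn_neqAle [psum y j * m]mulnC N andbT.
  by apply: contraNneq qj => ->; rewrite dvdn_mulr.
have [W|nW] := pselect (window m k y).
  have [r yr] := window_bsub km W N; rewrite yr in py pr *.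
  have [pd prd rl] := bsub_primitive km py pr.
  have [ks [a [[e1 H1] [e2 H2]]]] := IH _ dm _ d0 pd prd.
  exists (k :: ks); split; first by rewrite /= km.
  have dd : 1 < gcdn m k by lia.
  have [e1' [re1 H1']] := after1 dd pd prd H1.
  have [e2' [re2 H2']] := after0 dd pd prd H2.
  split; [exists (e1'.+1 * den m k)|exists (e2'.+1 * den m k)];
    rewrite shiftseq_bsub //= ?re1 ?re2; exact: bsub_sle.
have [[e1 H1] [e2 H2]] := not_window km py erefl nW.
have [ks a] := adm_exists d0; exists (k :: ks); split; first by rewrite /= km.
split; [exists e1; apply: sle_trans H1 _|exists e2; apply: sle_trans H2].
  by apply: bsub_sle => //; exact: sle_const0.
by apply: bsub_sle => //; exact: sle_const1.
Qed.

(** * Words and chains as sequences and lists *)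

Lemma wpow_periodic w : mperiodic (size w) (wpow w).
Proof. by move=> i; rewrite /wpow modnDl. Qed.

Lemma wpow_mkseq y n : 0 < n -> mperiodic n y -> wpow (mkseq y n) = y.
Proof.
move=> n0 py; apply/funext => i; rewrite /wpow size_mkseq nth_mkseq ?ltn_mod //.
exact: periodic_mod.
Qed.

Lemma rot_mkseq w i : 0 < size w -> i <= size w ->
  rot i w = mkseq (shiftseq i (wpow w)) (size w).
Proof.
move=> w0 iw; apply: (@eq_from_nth _ false); rewrite size_rot ?size_mkseq // => j jw.
rewrite nth_mkseq // /shiftseq /wpow /rot nth_cat size_drop nth_drop.
case: ltnP => h; first by rewrite modn_small //; lia.
rewrite nth_take; last by lia.
have -> : i + j = (j - (size w - i)) + size w by lia.
by rewrite modnDr modn_small //; lia.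
Qed.

Lemma lexi_nth (a b : word) n : size a = size b ->
  (forall i, i < n -> nth false a i = nth false b i) ->
  nth false a n = false -> nth false b n = true ->
  ((a : seqlexi bool) <= (b : seqlexi bool))%O.
Proof.
elim: a b n => [|x a IH] [|y b] // n.
move=> [sab]; rewrite lexi_cons; case: n => [|n] E /= an bn.
  by rewrite an bn.
have /= -> := E 0 isT; rewrite lexx /=.
by apply: (IH _ n) => // i ilt; exact: (E i.+1).
Qed.

Lemma lexi_sle (y z : binseq) n : sle y z ->
  ((mkseq y n : seqlexi bool) <= (mkseq z n : seqlexi bool))%O.
Proof.
move=> [-> //|[l [E yl zl]]]; have [ln|nl] := ltnP l n.
  apply: (@lexi_nth _ _ l); rewrite ?size_mkseq ?nth_mkseq // => i il.
  by rewrite !nth_mkseq ?E //; lia.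
suff -> : mkseq y n = mkseq z n by [].
by apply/eq_in_map => i; rewrite mem_iota add0n => /andP[_ h]; apply: E; lia.
Qed.

(** Rotations of a word are ordered as the shifts of its periodic sequence. *)
Lemma max_rot_eq w e : 0 < size w ->
  (forall n, sle (shiftseq n (wpow w)) (shiftseq e (wpow w))) ->
  max_rot w = mkseq (shiftseq e (wpow w)) (size w).
Proof.
move=> w0 H; have emod : e %% size w < size w by rewrite ltn_mod.
pose z : seqlexi bool := mkseq (shiftseq e (wpow w)) (size w).
have zE : rot (e %% size w) w = z.
  by rewrite rot_mkseq ?(ltnW emod) // shiftseq_mod //; exact: wpow_periodic.
apply: (@le_anti _ (seqlexi bool)); apply/andP; split.
  apply: bigmax_le => [|i _].
    by rewrite -[X in (X <= _)%O](rot0 w) rot_mkseq //; exact: lexi_sle.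
  by rewrite rot_mkseq ?(ltnW (ltn_ord i)) //; exact: lexi_sle.
have := @le_bigmax _ (seqlexi bool) _ w (fun i : 'I_(size w) => rot i w : seqlexi bool)
  (Ordinal emod).
by rewrite /= zE.
Qed.

Section FareyWords.
Variables (m k : nat).
Hypothesis km : 0 < k < m.
Let q := den m k.
Let floor_seq := bsub m k false (fun _ => true).
Let ceil_seq := bsub m k true (fun _ => false).

Lemma mechE j : floor_seq j = mech k m j.
Proof.
rewrite /floor_seq /bsub /mech; case: ifP => [qj|qj].
  by rewrite div_next_dvd // ltnn if_same.
by case: ifP => // qSj; rewrite div_prev_dvd // ltnSn.
Qed.

Lemma div_reduce j : j * (k %/ gcdn m k) %/ den m k = j * k %/ m.
Proof.
have d0 := gcd_gt0 km.
have E : j * k = j * (k %/ gcdn m k) * gcdn m k.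
  by rewrite -mulnA divnK ?dvdn_gcdr.
by rewrite E -[X in _ = _ %/ X](den_mul m k) divnMr.
Qed.

Lemma farey_mkseq : farey k m = mkseq floor_seq q.
Proof.
rewrite /farey /farey_coprime gcdnC; apply: eq_map => j.
rewrite mechE /mech !div_reduce.
by have /andP[] := div_le_next km j; lia_quot.
Qed.

Lemma floor_seq_periodic : mperiodic q floor_seq.
Proof.
move=> i; have := shiftseq_bsub km false (fun _ => true) 0; rewrite mul1n.
by move=> /(congr1 (fun y => y i)).
Qed.

Lemma wpow_farey : wpow (farey k m) = floor_seq.
Proof. by rewrite farey_mkseq wpow_mkseq ?den_gt0 //; exact: floor_seq_periodic. Qed.

(** Passing to the reduced fraction keeps the blocks, and makes the coprime case
    available for words whose slope is not given in lowest terms. *)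
Lemma bsub_reduce x r : bsub m k x r = bsub (den m k) (k %/ gcdn m k) x r.
Proof.
have d0 := gcd_gt0 km.
have co : gcdn (den m k) (k %/ gcdn m k) = 1.
  apply/eqP; rewrite -(eqn_pmul2r d0) mul1n muln_gcdl den_mul.
  by rewrite divnK ?dvdn_gcdr.
have dq : den (den m k) (k %/ gcdn m k) = den m k by rewrite {1}/den co divn1.
apply/funext => j; rewrite /bsub dq.
by case: ifP => // _; case: ifP => // _; rewrite /mech !div_reduce.
Qed.

Lemma floor_top : exists e, shiftseq e floor_seq = ceil_seq.
Proof.
have d0 := gcd_gt0 km.
have co : gcdn (den m k) (k %/ gcdn m k) = 1.
  apply/eqP; rewrite -(eqn_pmul2r d0) mul1n muln_gcdl den_mul.
  by rewrite divnK ?dvdn_gcdr.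
have km' : 0 < k %/ gcdn m k < den m k.
  by apply/andP; split; rewrite -(ltn_pmul2r d0) ?mul0n ?den_mul divnK
    ?dvdn_gcdr //; case/andP: km.
have [e [_ E]] := mech_top km' co; exists e.+1.
by rewrite /floor_seq /ceil_seq !bsub_reduce.
Qed.

Lemma max_rot_farey : max_rot (farey k m) = mkseq ceil_seq q.
Proof.
have [e E] := floor_top.
have sz : size (farey k m) = q by rewrite farey_mkseq size_mkseq.
rewrite (@max_rot_eq _ e) ?sz ?den_gt0 // wpow_farey E //.
by move=> n; apply: bsub_max.
Qed.

Lemma bsub_first x r i : i < q.-1 -> bsub m k x r i = bsub m k x (fun _ => true) i.
Proof.
have q1 := den_gt1 km; rewrite -/q in q1.
move=> iq; rewrite /bsub -/q; case: eqP => [->|/eqP i0]; first by rewrite dvdn0.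
by rewrite !gtnNdvd //; lia.
Qed.

(** Within the first block only the last letter depends on [r]. *)
Lemma set_last_bsub x r b :
  set_last (mkseq (bsub m k x r) q) b = mkseq (bsub m k x (fun _ => b)) q.
Proof.
have q1 := den_gt1 km; rewrite -/q in q1.
rewrite /set_last size_mkseq; apply: (@eq_from_nth _ false).
  by rewrite size_set_nth !size_mkseq; apply/maxn_idPr; lia.
move=> i; rewrite size_set_nth size_mkseq (maxn_idPr _); last by lia.
move=> iq; rewrite nth_set_nth /= !nth_mkseq //; case: eqP => [->|iE].
  by have := bsub_block km x (fun _ => b) 0; rewrite mul1n.
by rewrite bsub_first ?[RHS]bsub_first //; lia.
Qed.

(** The four blocks [1u0, 1u1, 0u0, 0u1] of the operation are [~a u b], where [a]
    and [b] are the two consecutive letters that select the block. *)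
Lemma subst_blockE a b :
  subst_block (farey k m) a b = mkseq (bsub m k (~~ a) (fun _ => b)) q.
Proof.
case: a; case: b; rewrite /subst_block /wplus /wminus ?max_rot_farey ?farey_mkseq //=.
all: by rewrite /ceil_seq /floor_seq ?set_last_bsub.
Qed.

Lemma nth_flatten_uniform (bl : seq word) n i : 0 < n ->
  (forall b, b \in bl -> size b = n) ->
  nth false (flatten bl) i = nth false (nth [::] bl (i %/ n)) (i %% n).
Proof.
move=> n0; elim: bl i => [|b bl IH] i H; first by rewrite !nth_nil.
have sb : size b = n by apply: H; rewrite mem_head.
rewrite /= nth_cat sb; case: ltnP => h.
  by rewrite divn_small // modn_small.
rewrite IH; last by move=> c cb; apply: H; rewrite in_cons cb orbT.
by rewrite -{3 4}(subnK h) divnDr // divnn n0 addn1 modnDr.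
Qed.

Lemma bullet_farey r : bullet (farey k m) r
  = mkseq (bsub m k (head false r) (wpow r)) (size r * q).
Proof.
have q1 := den_gt1 km; rewrite -/q in q1; have q0 := ltnW q1.
case: r => [|r1 r] //.
have -> : bullet (farey k m) (r1 :: r)
    = flatten (pairmap (subst_block (farey k m)) (~~ r1) (r1 :: r)).
  by case: r1.
have szb a b : size (subst_block (farey k m) a b) = q.
  by rewrite subst_blockE size_mkseq.
have allsz s x b : b \in pairmap (subst_block (farey k m)) x s -> size b = q.
  elim: s x => // y s IH x /=; rewrite in_cons => /orP[/eqP ->|/IH //].
  exact: szb.
have szf s x : size (flatten (pairmap (subst_block (farey k m)) x s)) = size s * q.
  by elim: s x => // y s IH x /=; rewrite size_cat IH szb.
apply: (@eq_from_nth _ false); rewrite szf ?size_mkseq // => i iq.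
rewrite (nth_flatten_uniform _ q0 (@allsz _ _)) nth_mkseq //.
have il : i %/ q < size (r1 :: r) by rewrite ltn_divLR.
rewrite (nth_pairmap false) // subst_blockE nth_mkseq ?ltn_mod //.
have rE l : l < size (r1 :: r) -> wpow (r1 :: r) l = nth false (r1 :: r) l.
  by move=> ls; rewrite /wpow modn_small.
rewrite /bsub -/q -[head _ _]/r1; have iE := divn_eq i q.
have qi : (q %| i) = (i %% q == 0) by [].
have qm : (q %| i %% q) = (i %% q == 0) by rewrite /dvdn modn_mod.
have qSi : (q %| i.+1) = (q %| (i %% q).+1).
  by rewrite /dvdn -addn1 -modnDml addn1.
rewrite qi qm qSi; case: eqP => [i0|i0].
  case: eqP => [->|in0]; first by rewrite div0n /= negbK.
  have il0 : 0 < i %/ q by rewrite divn_gt0 // dvdn_leq ?qi ?i0 //; lia.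
  rewrite rE; last by lia.
  by case: (i %/ q) il0.
case: ifP => h; first by rewrite rE.
have mq : m %| i %/ q * q * k by rewrite -den_dvd // dvdn_mull.
rewrite /mech [in RHS]iE -addnS; move: (i %/ q * q) (i %% q) mq => a t mq.
by rewrite (mulnDl a t) (mulnDl a t.+1) (divnDl (t * k) mq)
  (divnDl (t.+1 * k) mq) ltn_add2l.
Qed.
End FareyWords.

Lemma bigcd_cat2 m k (t : seq nat) :
  \big[gcdn/0]_(a <- m :: k :: t) a = \big[gcdn/0]_(a <- gcdn m k :: t) a.
Proof. by rewrite !big_cons gcdnA. Qed.

Lemma chain_gcd1 m ks : chain_gcd (m :: ks) 1 = m.
Proof. by rewrite /chain_gcd /= take0 big_seq1. Qed.

Lemma chain_gcdS m k ks i :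
  chain_gcd (m :: k :: ks) i.+2 = chain_gcd (gcdn m k :: ks) i.+1.
Proof. by rewrite /chain_gcd /= bigcd_cat2. Qed.

Lemma chain_wordE m ks : chain_word (m :: ks) = bullets
  [seq farey (nth 0 ks i) (chain_gcd (m :: ks) i.+1) | i <- iota 0 (size ks)].
Proof. by rewrite /chain_word /= (iotaDl 1 0) -map_comp. Qed.

Lemma chain_word1 m k : chain_word [:: m; k] = farey k m.
Proof. by rewrite chain_wordE /= chain_gcd1. Qed.

Lemma chain_wordS m k k' ks :
  chain_word [:: m, k, k' & ks]
  = bullet (farey k m) (chain_word [:: gcdn m k, k' & ks]).
Proof.
rewrite !chain_wordE.
have -> : iota 0 (size [:: k, k' & ks])
          = 0 :: map (addn 1) (iota 0 (size (k' :: ks))) by rewrite -iotaDl.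
rewrite map_cons -map_comp chain_gcd1.
rewrite (@eq_map _ _ _ (fun i =>
  farey (nth 0 (k' :: ks) i) (chain_gcd (gcdn m k :: k' :: ks) i.+1))) //.
by move=> i /=; rewrite add1n chain_gcdS.
Qed.

Lemma chain_word_ext m k ks : adm m (k :: ks) ->
  chain_word [:: m, k & ks] = mkseq (ext false m (k :: ks)) m.
Proof.
elim: ks m k => [|k' ks IH] m k /andP[km a].
  have d1 : gcdn m k = 1 by move/eqP: a.
  have qm : den m k = m by rewrite /den d1 divn1.
  by rewrite chain_word1 farey_mkseq // qm.
rewrite chain_wordS IH // bullet_farey // size_mkseq mulnC den_mul.
have d0 := gcd_gt0 km.
rewrite wpow_mkseq //; last exact: ext_periodic.
suff -> : head false (mkseq (ext false (gcdn m k) (k' :: ks)) (gcdn m k)) = false by [].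
by rewrite -nth0 nth_mkseq // ext_head.
Qed.

Lemma wpow_chain_word m k ks : adm m (k :: ks) ->
  wpow (chain_word [:: m, k & ks]) = ext false m (k :: ks).
Proof.
move=> a; have m0 : 0 < m by case/andP: a => /andP[]; lia.
by rewrite chain_word_ext // wpow_mkseq //; exact: ext_periodic.
Qed.

Lemma wpow_max_rot_chain_word m k ks : adm m (k :: ks) ->
  wpow (max_rot (chain_word [:: m, k & ks])) = ext true m (k :: ks).
Proof.
move=> a; have m0 : 0 < m by case/andP: a => /andP[]; lia.
have sz : size (chain_word [:: m, k & ks]) = m by rewrite chain_word_ext // size_mkseq.
have [e [_ E]] := ext_orbit a.
rewrite (@max_rot_eq _ e.+1) ?sz // wpow_chain_word // E.
  by rewrite wpow_mkseq //; exact: ext_periodic.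
by move=> n; exact: ext_max.
Qed.

Lemma admissibleE m c : admissible m c <-> exists2 ks, c = m :: ks & adm m ks.
Proof.
suff H ks n : (forall i, (1 <= i < size (n :: ks))%N ->
      (0 < nth 0 (n :: ks) i < chain_gcd (n :: ks) i)%N) /\
      chain_gcd (n :: ks) (size (n :: ks)) = 1 <-> adm n ks.
  split=> [[]|[ks -> /H[]]] //.
  by case: c => //= a ks [->] h1 h2; exists ks => //; apply/H.
elim: ks n => [|k ks IH] n /=.
  rewrite chain_gcd1; split=> [[_ /eqP] //|/eqP ->]; split=> // i; lia.
rewrite chain_gcdS; split.
  move=> [h1 h2]; apply/andP; split; first by have := h1 1 isT; rewrite chain_gcd1.
  apply/IH; split=> // i /andP[i1 ilt].
  have := h1 i.+1; rewrite /= ltnS ilt => /(_ isT).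
  by case: i i1 ilt => // i _ _; rewrite chain_gcdS.
move=> /andP[kn /IH[h1 h2]]; split=> // -[|[|i]] // h; first by rewrite chain_gcd1.
by rewrite chain_gcdS; exact: (h1 i.+1).
Qed.

Lemma chain_ltE c c' : chain_lt c c' <-> clt c c'.
Proof.
elim: c c' => [|a c IH] [|a' c'] /=; split=> //.
- by move=> [n []]; rewrite min0n.
- by move=> [n []]; rewrite min0n.
- by move=> [n []]; rewrite minn0.
- move=> [[|n] [nlt E /= H]]; first by rewrite H.
  apply/orP; right; have /= -> := E 0 isT; rewrite eqxx /=; apply/IH.
  exists n; split=> //; first by move: nlt; rewrite minnSS.
  by move=> i ilt; exact: (E i.+1).
- move=> /orP[aa|/andP[/eqP -> /IH[n [nlt E H]]]].
    by exists 0; split=> //; rewrite minnSS.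
  exists n.+1; split=> //; first by rewrite minnSS.
  by move=> [|i] //; exact: E.
Qed.

(** The first argument bounds the depth of the recursion, as in [psi_fuel]. *)
Fixpoint chain_enum (f n : nat) : seq (seq nat) :=
  if f is f'.+1 then
    if n <= 1 then nseq n [::]
    else flatten [seq [seq k :: ks | ks <- chain_enum f' (gcdn n k)]
                 | k <- index_iota 1 n]
  else [::].

Lemma size_chain_enum f n : size (chain_enum f n) = psi_fuel f n.
Proof.
elim: f n => //= f IH n; case: ifP => _; first by rewrite size_nseq.
rewrite size_flatten /shape -map_comp sumnE big_map.
by apply: eq_bigr => k _ /=; rewrite size_map IH.
Qed.

Lemma mem_chain_enum f n ks : n <= f -> 0 < n ->
  (ks \in chain_enum f n) = adm n ks.
Proof.
elim: f n ks => [|f IH] n ks nf n0; first by lia.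
have [n1|n1] := leqP n 1.
  have -> : n = 1 by lia.
  by rewrite /= mem_seq1; apply/eqP/idP => [-> //|/adm1].
rewrite /= leqNgt n1 /=; case: ks => [|k ks] /=.
  rewrite (gtn_eqF n1); apply/negbTE/flatten_mapP => -[k _].
  by case/mapP.
apply/flatten_mapP/andP => [[k' kn /mapP[ks' h [-> ->]]]|[kn a]].
  rewrite mem_index_iota in kn; split=> //; rewrite -IH //.
    by have := gcd_lt kn; lia.
  exact: (gcd_gt0 kn).
exists k; first by rewrite mem_index_iota.
apply/map_f; rewrite IH //; first by have := gcd_lt kn; lia.
exact: (gcd_gt0 kn).
Qed.

Lemma chain_enum_uniq f n : uniq (chain_enum f n).
Proof.
elim: f n => //= f IH n; case: ifP => n1; first by case: n n1 => [|[]].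
have : uniq (index_iota 1 n) by exact: iota_uniq.
elim: (index_iota 1 n) => //= k l IHl /andP[kl /IHl u].
rewrite cat_uniq u andbT map_inj_uniq ?IH /=; last by move=> x y [].
apply/hasPn => ks /flatten_mapP[k' k'l /mapP[ks' _ ->]].
by apply/mapP => -[ks2 _ [E _]]; move: kl; rewrite -E k'l.
Qed.

(** * Values of periodic sequences in a base *)

Local Open Scope classical_set_scope.
Local Open Scope ring_scope.

Section Values.
Variables (R : realType) (m : nat).
Hypothesis m0 : (0 < m)%N.
Implicit Types (b : R) (y z : nat -> bool).

(** The sum of the series of digits, as a finite geometric sum: a period of
    digits read as an integer in base [b], divided by [b ^+ m - 1]. *)
Definition pval y b : R :=
  (\sum_(j < m) (nat_of_bool (y j))%:R * b ^+ (m.-1 - j)) / (b ^+ m - 1).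

Lemma expB_gt0 b : 1 < b -> 0 < b ^+ m - 1.
Proof. by move=> b1; rewrite subr_gt0 exprn_egt1 // -lt0n. Qed.

Lemma pval_rec y b : 1 < b -> mperiodic m y ->
  b * pval y b = (nat_of_bool (y 0%N))%:R + pval (shiftseq 1 y) b.
Proof.
move=> b1 py; have D := expB_gt0 b1; rewrite /pval.
rewrite mulrA -[(nat_of_bool (y 0%N))%:R](mulfK (lt0r_neq0 D)) -mulrDl; congr (_ / _).
have := py 0%N; rewrite addn0; case: m m0 => // n _ yn.
rewrite big_ord_recl [in RHS]big_ord_recr /= subn0 subnn expr0 mulr1.
rewrite /shiftseq (add1n n) yn mulrDr.
have -> : b * \sum_(i < n) (nat_of_bool (y (bump 0 i)))%:R * b ^+ (n - bump 0 i)
          = \sum_(i < n) (nat_of_bool (y (1 + i)%N))%:R * b ^+ (n - i).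
  rewrite mulr_sumr; apply: eq_bigr => j _; rewrite mulrCA -exprS.
  by congr (_ * _ ^+ _); have := ltn_ord j; rewrite /bump /=; lia.
by rewrite exprS; ring.
Qed.

Lemma pval_ge0 y b : 1 < b -> 0 <= pval y b.
Proof.
move=> b1; apply: divr_ge0; last exact/ltW/expB_gt0.
by apply: sumr_ge0 => j _; rewrite mulr_ge0 ?ler0n // exprn_ge0 //; lra.
Qed.

Lemma pval_gt0 y b : 1 < b -> mperiodic m y -> (exists i, y i) -> 0 < pval y b.
Proof.
move=> b1 py [i yi]; apply: divr_gt0; last exact: expB_gt0.
have im : (i %% m < m)%N by rewrite ltn_mod.
rewrite (bigD1 (Ordinal im)) //= periodic_mod // yi mul1r.
rewrite ltr_pwDl ?exprn_gt0 //; first by lra.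
by apply: sumr_ge0 => j _; rewrite mulr_ge0 ?ler0n // exprn_ge0 //; lra.
Qed.

Lemma pval_bound b : 1 < b -> exists C, forall y, `|pval y b| <= C.
Proof.
move=> b1; exists ((\sum_(j < m) b ^+ (m.-1 - j)) / (b ^+ m - 1)) => y.
rewrite ger0_norm ?pval_ge0 // /pval ler_pM2r ?invr_gt0 ?expB_gt0 //.
apply: ler_sum => j _; rewrite ler_piMl ?exprn_ge0 //; first by lra.
by case: (y j).
Qed.

(** Iterating [b * v = y 0 + v'], where [v'] is the value of the shifted sequence,
    leaves after [n] digits a remainder of a bounded value over [b ^+ n]. *)
Lemma pval_expansion y b : 1 < b -> mperiodic m y -> expansion y b = pval y b.
Proof.
move=> b1 py; have b0 : 0 < b by lra.
have [C HC] := pval_bound b1.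
have E n : series (fun i => (nat_of_bool (y i))%:R / b ^+ i.+1) n
           = pval y b - pval (shiftseq n y) b * b^-1 ^+ n.
  elim: n => [|n IH]; first by rewrite seriesEnat /= big_geq // expr0 mulr1 shiftseq0 subrr.
  rewrite seriesSr IH -!addrA; congr (_ + _).
  have := pval_rec b1 (periodic_shiftseq n py).
  rewrite shiftseqD addn1 {2}/shiftseq addn0 => H.
  have -> : pval (shiftseq n y) b = b^-1 * ((nat_of_bool (y n))%:R + pval (shiftseq n.+1 y) b).
    by rewrite -H mulKf // lt0r_neq0.
  by rewrite !exprVn !exprS; field; rewrite ?expf_neq0 ?lt0r_neq0.
apply/cvg_lim => //; rewrite (funext E) -[X in _ --> X]subr0.
apply: cvgB; first exact: cvg_cst.
apply: (@squeeze_cvgr _ _ _ _ (fun n => - (C * b^-1 ^+ n)) (fun n => C * b^-1 ^+ n)).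
- near=> n; have bn : 0 <= b^-1 ^+ n by rewrite exprn_ge0 // invr_ge0 ltW.
  rewrite -ler_norml normrM (ger0_norm bn); exact: ler_wpM2r.
- rewrite -oppr0; apply: cvgN; rewrite -(mulr0 C); apply: cvgM; first exact: cvg_cst.
  by apply: cvg_expr; rewrite ger0_norm ?invr_ge0 ?ltW // invf_lt1.
- rewrite -(mulr0 C); apply: cvgM; first exact: cvg_cst.
  by apply: cvg_expr; rewrite ger0_norm ?invr_ge0 ?ltW // invf_lt1.
Unshelve. all: by end_near. Qed.

Lemma pval_diff y z b n : 1 < b -> mperiodic m y -> mperiodic m z ->
  (forall i, (i < n)%N -> y i = z i) ->
  b ^+ n * (pval z b - pval y b) = pval (shiftseq n z) b - pval (shiftseq n y) b.
Proof.
move=> b1 py pz; elim: n => [|n IH] E; first by rewrite expr0 mul1r !shiftseq0.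
rewrite exprS -mulrA IH => [|i ilt]; last by apply: E; lia.
rewrite mulrBr !pval_rec // ?shiftseqD ?addn1; try exact: periodic_shiftseq.
rewrite /shiftseq !addn0 E // -/(shiftseq n.+1 z); lra.
Qed.

Lemma pval_anti y b b' : 1 < b -> b < b' -> mperiodic m y -> (exists i, y i) ->
  pval y b' < pval y b.
Proof.
move=> b1 bb py [i yi]; have b1' : 1 < b' by lra.
have D := expB_gt0 b1; have D' := expB_gt0 b1'.
have im : (i %% m < m)%N by rewrite ltn_mod.
have term (j : 'I_m) : b' ^+ (m.-1 - j) / (b' ^+ m - 1) < b ^+ (m.-1 - j) / (b ^+ m - 1).
  rewrite ltr_pdivrMr // mulrAC ltr_pdivlMr //.
  have jm := ltn_ord j; set a := (m.-1 - j)%N.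
  have -> : m = (a + j.+1)%N by rewrite /a; lia.
  rewrite !exprD !mulrBr !mulr1.
  have h1 : b ^+ a <= b' ^+ a by rewrite lerXn2r ?nnegrE //; lra.
  have h2 : b ^+ j.+1 < b' ^+ j.+1 by rewrite ltrXn2r ?nnegrE //; lra.
  have ba : 0 < b ^+ a by rewrite exprn_gt0 //; lra.
  have ba' : 0 < b' ^+ a by rewrite exprn_gt0 //; lra.
  have h3 : b ^+ a * b' ^+ a * b ^+ j.+1 < b ^+ a * b' ^+ a * b' ^+ j.+1.
    by rewrite ltr_pM2l // mulr_gt0.
  nra.
rewrite /pval !mulr_suml (bigD1 (Ordinal im)) //= [ltRHS](bigD1 (Ordinal im)) //=.
rewrite periodic_mod // yi !mul1r; apply: ltr_leD; first exact: (term (Ordinal im)).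
by apply: ler_sum => j _; rewrite -!mulrA ler_wpM2l ?ler0n // ltW.
Qed.

Lemma pval_continuous y b : 1 < b -> pval y x @[x --> b] --> pval y b.
Proof.
move=> b1; have D := expB_gt0 b1; apply: cvgM; last first.
  apply: cvgV; first by rewrite lt0r_neq0.
  by apply: cvgB; [exact: exprn_continuous|exact: cvg_cst].
apply: cvg_big => [|j _]; first exact: add_continuous.
apply: cvgM; first exact: cvg_cst.
exact: exprn_continuous.
Qed.

(** In base 1 the digits of a period sum to more than [1 ^+ m - 1 = 0], and in
    base 2 a period reads as an integer below [2 ^+ m - 1], as some digit is 0. *)
Lemma pval_root y : mperiodic m y -> (exists i, y i) -> (exists i, ~~ y i) ->
  exists2 b : R, 1 < b < 2 & pval y b = 1.
Proof.
move=> py [i yi] [i' yi'].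
pose p : {poly R} := 'X^m - 1 - \sum_(j < m) (nat_of_bool (y j))%:R *: 'X^(m.-1 - j).
have pE b : p.[b] = b ^+ m - 1 - \sum_(j < m) (nat_of_bool (y j))%:R * b ^+ (m.-1 - j).
  rewrite !hornerE ?hornerXn horner_sum; congr (_ - _).
  by apply: eq_bigr => j _; rewrite !hornerE ?hornerXn.
have im : (i %% m < m)%N by rewrite ltn_mod.
have im' : (i' %% m < m)%N by rewrite ltn_mod.
have p1 : p.[1] < 0.
  rewrite pE expr1n subrr sub0r oppr_lt0 (bigD1 (Ordinal im)) //=.
  rewrite periodic_mod // yi expr1n mulr1 ltr_pwDl //.
  by apply: sumr_ge0 => j _; rewrite mulr_ge0 ?ler0n // expr1n.
have p2 : 0 < p.[2].
  have geo : 2 ^+ m - 1 = \sum_(j < m) 2 ^+ (m.-1 - j) :> R.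
    have -> : \sum_(j < m) 2 ^+ (m.-1 - j) = \sum_(j < m) 2 ^+ j :> R.
      rewrite (reindex_inj rev_ord_inj) /=; apply: eq_bigr => j _.
      by congr (_ ^+ _); have := ltn_ord j; lia.
    elim: m => [|n IH]; first by rewrite expr0 big_ord0 subrr.
    by rewrite big_ord_recr /= -IH exprS; ring.
  rewrite pE subr_gt0 geo (bigD1 (Ordinal im')) //= [ltRHS](bigD1 (Ordinal im')) //=.
  rewrite periodic_mod // (negbTE yi') mul0r; apply: ltr_leD; first exact: exprn_gt0.
  apply: ler_sum => j _; rewrite ler_piMl ?exprn_ge0 //; first by case: (y j).
have le12 : (1 : R) <= 2 by lra.
have sgn : p.[1] <= 0 <= p.[2] by rewrite !ltW.
have [b /andP[b1 b2] /rootP rb] := poly_ivt le12 sgn.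
have {}b1 : 1 < b by rewrite lt_neqAle b1 andbT; apply/eqP => E; rewrite -E in rb; lra.
have {}b2 : b < 2 by rewrite lt_neqAle b2 andbT; apply/eqP => E; rewrite E in rb; lra.
exists b; first by rewrite b1.
move: rb; rewrite pE => /eqP; rewrite subr_eq0 => /eqP rb.
by rewrite /pval -rb divff // lt0r_neq0 // expB_gt0.
Qed.

(** For [y] of period [m], the condition for being the digit sequence of an orbit
    in base [b]. *)
Definition realized y b : Prop := forall n, pval (shiftseq n y) b < 1.

Lemma realized_shiftseq y b n : realized y b -> realized (shiftseq n y) b.
Proof. by move=> H i; rewrite shiftseqD. Qed.

(** At the first difference [n], the values differ by
    [(1 + pval z' - pval y') / b ^+ n.+1], where [y'] and [z'] are the tails
    and the value of [y'] is below 1. *)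
Lemma realized_slt y z b : 1 < b -> mperiodic m y -> mperiodic m z ->
  realized y b -> slt y z -> pval y b < pval z b.
Proof.
move=> b1 py pz ry [n [E yn zn]]; rewrite -subr_gt0.
rewrite -(pmulr_rgt0 _ (exprn_gt0 n.+1 (lt_trans ltr01 b1))).
rewrite exprS -mulrA (pval_diff b1 py pz E) mulrBr.
rewrite !pval_rec // ?shiftseqD ?addn1; try exact: periodic_shiftseq.
rewrite {1 3}/shiftseq !addn0 yn zn.
have := ry n.+1; have := pval_ge0 (shiftseq n.+1 z) b1; rewrite /=; lra.
Qed.

Lemma realized_sle y z b : 1 < b -> mperiodic m y -> mperiodic m z ->
  realized y b -> sle y z -> pval y b <= pval z b.
Proof. by move=> b1 py pz ry [-> //|/realized_slt H]; exact/ltW/H. Qed.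

(** If [y] is not realized, let [M >= 1] be the largest value of a shift [y'] of
    [y].  If [y'] is not [z] itself, the tails at their first difference give
    [pval z - M >= (1 + pval z' - M) / b ^+ n.+1 > 1 - M], where the tail [z']
    of [z] has positive value, so [pval z > 1]. *)
Lemma realized_below y z b : 1 < b -> mperiodic m y -> mperiodic m z ->
  (exists i, z i) -> (forall n, sle (shiftseq n y) z) -> pval z b <= 1 ->
  pval z b < 1 \/ (forall n, slt (shiftseq n y) z) -> realized y b.
Proof.
move=> b1 py pz [i zi] H z1 strict.
have [j jmax] : exists j, forall n, pval (shiftseq n y) b <= pval (shiftseq j y) b.
  pose o := Ordinal m0.
  have [j _ jmax] := @arg_maxP _ _ _ o xpredT (fun j : 'I_m => pval (shiftseq j y) b) isT.
  exists j => n; rewrite -(shiftseq_mod n py).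
  by apply: (jmax (Ordinal (ltn_pmod n m0))).
set M := pval (shiftseq j y) b in jmax; suff M1 : M < 1.
  by move=> n; exact: le_lt_trans (jmax n) M1.
rewrite ltNge; apply/negP => M1; have Hj := H j.
have pj := periodic_shiftseq j py.
have [jz|] : shiftseq j y = z \/ slt (shiftseq j y) z by exact: H.
  case: strict => [|/(_ j)]; first by rewrite -jz -/M; lra.
  by rewrite jz; exact: slt_irr.
move=> [n [E yn zn]].
have b0 : 0 < b by lra.
have := pval_diff b1 pj pz E; rewrite -/M shiftseqD => D.
have := pval_rec b1 (periodic_shiftseq n pj); have := pval_rec b1 (periodic_shiftseq n pz).
rewrite !shiftseqD !addn1 {2 5}/shiftseq !addn0.
have -> : y (j + n)%N = false by exact: yn.
rewrite zn /= => Rz Ry.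
have h1 := jmax (j + n).+1.
have h2 : 0 < pval (shiftseq n.+1 z) b.
  apply: pval_gt0 => //; first exact: periodic_shiftseq.
  by exists (i + (n.+1 * m - n.+1))%N; rewrite /shiftseq addnCA subnKC ?leq_pmulr //
    addnC periodicM.
have h3 : b ^+ n.+1 * (pval z b - M) > 1 - M.
  rewrite exprS -mulrA D mulrBr Rz Ry; lra.
have h4 : 1 <= b ^+ n.+1 by apply: exprn_ege1; exact: ltW.
nra.
Qed.

End Values.

(** * Periodic orbits of the beta-transformation *)

Section Orbits.
Variables (R : realType) (m : nat) (b : R).
Hypotheses (m1 : (1 < m)%N) (b1 : 1 < b) (b2 : b <= 2).
Let m0 : (0 < m)%N. Proof. exact: ltnW. Qed.

Lemma beta_mapE (d : bool) (x : R) : 0 <= x < 1 ->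
  beta_map b ((d%:R + x) / b) = x /\ (1 <= b * ((d%:R + x) / b)) = d.
Proof.
move=> /andP[x0 x1]; have b0 : b != 0 by rewrite lt0r_neq0 // (lt_trans ltr01).
have -> : b * ((d%:R + x) / b) = d%:R + x by rewrite mulrC divfK.
split; last first.
  by case: d => /=; rewrite ?lerDl ?add0r //; apply/negbTE; rewrite -ltNge.
rewrite /beta_map; have -> : b * ((d%:R + x) / b) = d%:R + x by rewrite mulrC divfK.
have -> : Num.floor (d%:R + x) = (d : nat)%:Z.
  apply: floor_def; rewrite intrD -pmulrn mulr1z; apply/andP; split.
    by rewrite lerDl.
  by rewrite ltrD2l.
by rewrite -pmulrn addrC addrA addNr add0r.
Qed.

Lemma iter_beta_pval y n : mperiodic m y -> realized m y b ->
  iter n (beta_map b) (pval m y b) = pval m (shiftseq n y) b.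
Proof.
move=> py ry; elim: n => [|n IH]; first by rewrite shiftseq0.
rewrite iterS IH.
have pn := periodic_shiftseq n py; have := pval_rec m0 b1 pn.
rewrite shiftseqD addn1 => /(canRL (mulKf _)) -> //; last by rewrite lt0r_neq0 // (lt_trans ltr01).
by rewrite mulrC; apply: (proj1 (beta_mapE _ _)); rewrite ry pval_ge0.
Qed.

Lemma pval_digit y : mperiodic m y -> realized m y b -> y 0%N = (1 <= b * pval m y b).
Proof.
move=> py ry; have := pval_rec m0 b1 py.
move=> /(canRL (mulKf _)) ->; last by rewrite lt0r_neq0 // (lt_trans ltr01).
rewrite (mulrC b^-1); symmetry; apply: (proj2 (beta_mapE _ _)).
by rewrite ry pval_ge0.
Qed.

(** Equal points of an orbit have equal digits from there on. *)
Lemma pval_smallest_period y : mperiodic m y -> mprimitive m y -> realized m y b ->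
  has_smallest_period b m (pval m y b).
Proof.
move=> py pr ry; split=> //.
  rewrite iter_beta_pval //; congr (pval m _ b).
  by apply/funext => j; exact: py.
move=> i im E; apply: (pr i im); apply/funext => n.
have En : pval m (shiftseq (i + n) y) b = pval m (shiftseq n y) b.
  rewrite -shiftseqD -!iter_beta_pval //; first by rewrite E.
  - exact: periodic_shiftseq.
  - exact: realized_shiftseq.
have D j : y j = (1 <= b * pval m (shiftseq j y) b).
  rewrite -pval_digit ?/shiftseq ?addn0 //; first exact: periodic_shiftseq.
  exact: realized_shiftseq.
by rewrite /shiftseq !D -En.
Qed.

(** The digit sequence of a periodic orbit has the orbit as its values: the
    difference [D n] of the two satisfies [D n.+1 = b * D n] and is periodic. *)
Lemma orbit_digits (x : R) : has_smallest_period b m x ->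
  (forall n, 0 <= iter n (beta_map b) x < 1) ->
  exists y, [/\ mperiodic m y, mprimitive m y &
    forall n, iter n (beta_map b) x = pval m (shiftseq n y) b].
Proof.
move=> [_ xm xi] Hx.
pose g n := iter n (beta_map b) x.
have gm n : g (m + n)%N = g n by rewrite /g addnC iterD xm.
pose y n := 1 <= b * g n.
have py : mperiodic m y by move=> n; rewrite /y gm.
have rec n : b * g n = (y n : nat)%:R + g n.+1.
  rewrite /g iterS -/(g n) /beta_map.
  have -> : Num.floor (b * g n) = (y n : nat)%:Z; last by rewrite -pmulrn addrC subrK.
  apply: floor_def; rewrite intrD -pmulrn mulr1z.
  have := Hx n; rewrite -/(g n) => /andP[g0 g1]; have [h1 h2] := (b1, b2).
  have bg : b * g n < 2 by nra.
  have bg0 : 0 <= b * g n by nra.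
  by rewrite /y; case: (leP 1 (b * g n)) => h /=; apply/andP; split; lra.
have eqg n : g n = pval m (shiftseq n y) b.
  pose D n := g n - pval m (shiftseq n y) b.
  have DS i : D i.+1 = b * D i.
    rewrite /D mulrBr rec pval_rec //; last exact: periodic_shiftseq.
    by rewrite shiftseqD addn1 {2}/shiftseq addn0; lra.
  have DX i k : D (i + k)%N = b ^+ i * D k.
    by elim: i => [|i IH]; rewrite ?expr0 ?mul1r // addSn DS IH exprS mulrA.
  have Dm : D (m + n)%N = D n.
    rewrite /D gm; congr (_ - pval m _ b); apply/funext => j.
    by rewrite /shiftseq -addnA py.
  have bm := expB_gt0 m0 b1.
  have : (b ^+ m - 1) * D n = 0 by rewrite mulrBl mul1r -DX Dm subrr.
  by move/eqP; rewrite mulf_eq0 gt_eqF //= subr_eq0 => /eqP.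
exists y; split=> // i im E; apply: (xi i im).
by rewrite -[LHS]/(g i) eqg E -[y]shiftseq0 -eqg.
Qed.

Lemma mem_tau_set (t : R) :
  (0 <= t < 1 /\ exists2 x, has_smallest_period b m x &
                            orbit_of b x `<=` survivor_set b t) <->
  (0 <= t < 1 /\ exists y, [/\ mperiodic m y, mprimitive m y, realized m y b &
                               forall n, t <= pval m (shiftseq n y) b]).
Proof.
split=> -[t01 H]; split=> //; last first.
  case: H => y [py pr ry ty]; exists (pval m y b); first exact: pval_smallest_period.
  move=> _ [n _ <-]; rewrite iter_beta_pval //; split; first by rewrite ry pval_ge0.
  move=> n'; rewrite iter_beta_pval.
  - by rewrite shiftseqD negb_and -!leNgt ty orbT.
  - exact: periodic_shiftseq.
  - exact: realized_shiftseq.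
case: H => x px Hx.
have Hn n : survivor_set b t (iter n (beta_map b) x) by apply: Hx; exists n.
have [y [py pr E]] := orbit_digits px (fun n => (Hn n).1).
exists y; split=> // n; rewrite -E; first by case/andP: ((Hn n).1).
have := (Hn n).2 0%N; rewrite /= negb_and -!leNgt => /orP[|//].
rewrite E leNgt pval_gt0 //; first exact: periodic_shiftseq.
by apply: (both_digits true m1); exact: primitive_shiftseq.
Qed.
End Orbits.

(** * The critical value *)

Section Critical.
Variables (R : realType) (m : nat).
Hypothesis m1 : (1 < m)%N.
Let m0 : (0 < m)%N. Proof. exact: ltnW. Qed.
Implicit Types (b : R) (ks : seq nat).

Definition cbase ks : R := chain_base (m :: ks).

Local Notation lo := (ext false m).
Local Notation hi := (ext true m).

Lemma adm_cons ks : adm m ks -> exists k ks', ks = k :: ks'.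
Proof. by case: ks => [/eqP E|k ks' _]; [move: m1; rewrite E|exists k, ks']. Qed.

Lemma ext_max_adm ks n : adm m ks -> sle (shiftseq n (lo ks)) (hi ks).
Proof. by move=> a; have [k [ks' E]] := adm_cons a; rewrite E in a *; exact: ext_max. Qed.

Lemma ext_orbit_adm ks : adm m ks ->
  exists e, lo ks e = false /\ shiftseq e.+1 (lo ks) = hi ks.
Proof. by move=> a; have [k [ks' E]] := adm_cons a; rewrite E in a *; exact: ext_orbit. Qed.

Lemma ext_primitive ks : adm m ks -> mprimitive m (lo ks).
Proof. by move=> a i im E; have := ext_lyndon a im; rewrite E; exact: slt_irr. Qed.

Lemma ext_min ks n : adm m ks -> sle (lo ks) (shiftseq n (lo ks)).
Proof.
move=> a; rewrite -(shiftseq_mod n (ext_periodic _ a)).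
have : (n %% m < m)%N by rewrite ltn_mod.
case: (n %% m)%N => [|i] im; first by rewrite shiftseq0; left.
by right; apply: ext_lyndon.
Qed.

Lemma ext_hi_digit ks : adm m ks -> exists i, hi ks i.
Proof.
move=> a; have [k [ks' E]] := adm_cons a; exists 0%N.
by rewrite E ext_head.
Qed.

Lemma chain_word_adm ks : adm m ks -> wpow (chain_word (m :: ks)) = lo ks.
Proof.
by move=> a; have [k [ks' E]] := adm_cons a; rewrite E in a *; exact: wpow_chain_word.
Qed.

(** The value of the largest sequence decreases strictly with the base, so the
    equation has a single solution. *)
Lemma cbaseP ks : adm m ks -> 1 < cbase ks < 2 /\ pval m (hi ks) (cbase ks) = 1.
Proof.
move=> a; have py := ext_periodic true a; have h1 := ext_hi_digit a.
have h0 : exists i, ~~ hi ks i by exists m.-1; rewrite ext_last.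
have [b0 b12 vb0] := pval_root R m0 py h1 h0.
rewrite /cbase /chain_base; set S := [set b | _].
have wE : wpow (max_rot (chain_word (m :: ks))) = hi ks.
  by have [k [ks' E]] := adm_cons a; rewrite E in a *; exact: wpow_max_rot_chain_word.
have SE b : S b -> 1 < b < 2 /\ pval m (hi ks) b = 1.
  by move=> [/andP[c1 c2]]; rewrite wE (pval_expansion m0 c1 py) c1 c2.
have : (S `&` ubound S) (xget 0 (S `&` ubound S)).
  apply: xgetPex; exists b0; split.
    by split=> //; rewrite wE (pval_expansion m0 _ py) //; case/andP: b12.
  move=> b /SE[/andP[c1 c2] vb]; rewrite leNgt; apply/negP => lt.
  by have := pval_anti m0 (proj1 (andP b12)) lt py h1; rewrite vb vb0 ltxx.
by move=> [/SE].
Qed.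

Lemma realized_cbase ks b : 1 < b -> adm m ks -> realized m (lo ks) b -> cbase ks < b.
Proof.
move=> b1 a ra; have [/andP[c1 c2] v] := cbaseP a.
have [e [_ E]] := ext_orbit_adm a; have := ra e.+1; rewrite E => v1.
rewrite ltNge; apply/negP => bc; move: v1.
suff : 1 <= pval m (hi ks) b by lra.
rewrite -v; move: bc; rewrite le_eqVlt => /orP[/eqP -> //|bc].
exact/ltW/(pval_anti m0 b1 bc)/(ext_hi_digit a)/(ext_periodic _ a).
Qed.

Lemma cbase_realized ks b : adm m ks -> cbase ks < b -> realized m (lo ks) b.
Proof.
move=> a cb; have [/andP[c1 c2] v] := cbaseP a.
have py := ext_periodic true a; have h1 := ext_hi_digit a.
have v1 : pval m (hi ks) b < 1 by rewrite -v; exact: pval_anti.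
apply: (realized_below m0 _ (ext_periodic false a) py h1) => //; first by lra.
- by move=> n; exact: ext_max_adm.
- exact: ltW.
- by left.
Qed.

(** In the base of the larger chain its largest sequence has value 1, and every
    shift of the smaller chain is strictly below that sequence. *)
Lemma cbase_slt ks ks' : adm m ks -> adm m ks' -> clt ks ks' ->
  cbase ks < cbase ks'.
Proof.
move=> a a' c; have [/andP[c1 c2] v] := cbaseP a'.
have H n : slt (shiftseq n (lo ks)) (hi ks').
  exact: sle_slt_trans (ext_max_adm n a) (ext_slt true a a' c).
apply: realized_cbase => //.
apply: (realized_below m0 c1 (ext_periodic false a) (ext_periodic true a')).
- exact: ext_hi_digit.
- by move=> n; right.
- by rewrite v.
- by right.
Qed.

Lemma cbase_ltP ks ks' : adm m ks -> adm m ks' ->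
  cbase ks < cbase ks' <-> clt ks ks'.
Proof.
move=> a a'; split=> [lt|]; last exact: cbase_slt.
case: (clt_total a a') => [E|//|/(cbase_slt a' a)]; last by lra.
by rewrite E ltxx in lt.
Qed.

Lemma cbase_inj ks ks' : adm m ks -> adm m ks' -> cbase ks = cbase ks' -> ks = ks'.
Proof.
by move=> a a' E; case: (clt_total a a') => // /cbase_slt H;
  [have := H a a'|have := H a' a]; rewrite E ltxx.
Qed.

Lemma cbase_le_lo ks ks' : adm m ks -> adm m ks' -> cbase ks <= cbase ks' ->
  sle (lo ks) (lo ks').
Proof.
move=> a a' le; case: (clt_total a a') => [->|c|c]; first by left.
  by right; exact: ext_slt.
by have := cbase_slt a' a c; lra.
Qed.

(** The dominating chain is itself realized, as every shift of its sequence lies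
    below a shift of [y], whose value is less than 1. *)
Lemma realized_chain y b : 1 < b -> mperiodic m y -> mprimitive m y ->
  realized m y b -> exists ks, [/\ adm m ks, cbase ks < b &
    exists e, sle (shiftseq e y) (lo ks)].
Proof.
move=> b1 py pr ry; have [ks [a [[e1 H1] [e2 H2]]]] := domination m0 py pr.
exists ks; split=> //; last by exists e1.
apply: realized_cbase => //.
apply: (realized_below m0 b1 (ext_periodic false a) (periodic_shiftseq e2 py)).
- have [i yi] := both_digits true m1 (primitive_shiftseq (n := e2) m0 py pr).
  by exists i.
- by move=> n; exact: sle_trans (ext_max_adm n a) H2.
- exact: ltW.
- by left; exact: ry.
Qed.

(** Any other realized orbit is dominated by the orbit of a chain whose base is
    below [b], so by that of [ks], whose smallest sequence is larger. *)
Lemma tau_chain ks b : 1 < b <= 2 -> adm m ks -> cbase ks < b ->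
  (forall ks', adm m ks' -> cbase ks' < b -> cbase ks' <= cbase ks) ->
  tau m b = pval m (lo ks) b.
Proof.
move=> hb a cb Hmax; case/andP: hb => b1 b2.
have plo := ext_periodic false a; have rlo := cbase_realized a cb.
have v1 := rlo 0%N; rewrite shiftseq0 in v1.
have v0 := pval_ge0 m0 (lo ks) b1.
rewrite /tau; set A := [set t | _].
have AP t : A t <-> _ := mem_tau_set m1 b1 b2 t.
have Av : A (pval m (lo ks) b).
  apply/AP; split; first by rewrite v0 v1.
  exists (lo ks); split=> //; first exact: ext_primitive.
  move=> n; apply: realized_sle => //; first exact: periodic_shiftseq.
  exact: ext_min.
have ubA : ubound A (pval m (lo ks) b).
  move=> t /AP[_ [y [py pr ry ty]]].
  have [ks' [a' cb' [e H]]] := realized_chain b1 py pr ry.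
  apply: le_trans (ty e) _.
  have ple := ext_periodic false a'.
  apply: le_trans (realized_sle m0 b1 (periodic_shiftseq e py) ple _ H) _.
    exact: realized_shiftseq.
  apply: realized_sle => //; first exact: cbase_realized.
  exact: cbase_le_lo (Hmax _ a' cb').
apply/le_anti/andP; split; first by apply: ge_sup => //; exists (pval m (lo ks) b).
by apply: ub_le_sup => //; exists (pval m (lo ks) b).
Qed.

Lemma tau_no_chain b : 1 < b <= 2 -> (forall ks, adm m ks -> b <= cbase ks) ->
  tau m b = 0.
Proof.
move=> /andP[b1 b2] H; rewrite /tau; set A := [set t | _].
have -> : A = set0; last by rewrite sup0.
apply/seteqP; split=> // t /(mem_tau_set m1 b1 b2)[_ [y [py pr ry _]]].
have [ks [a cb _]] := realized_chain b1 py pr ry.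
by have := H ks a; lra.
Qed.

Definition chains : seq (seq nat) := chain_enum m m.

Lemma mem_chains ks : (ks \in chains) = adm m ks.
Proof. exact: mem_chain_enum. Qed.

Lemma seq_max (T : eqType) (f : T -> R) (s : seq T) : s != [::] ->
  exists2 x, x \in s & forall z, z \in s -> f z <= f x.
Proof.
elim: s => // x s IH _; have [->|/IH[y ys Hy]] := eqVneq s [::].
  by exists x; rewrite ?mem_head // => z; rewrite mem_seq1 => /eqP ->.
have [xy|yx] := leP (f x) (f y).
  exists y; first by rewrite in_cons ys orbT.
  by move=> z; rewrite in_cons => /orP[/eqP -> //|/Hy].
exists x; first by rewrite mem_head.
move=> z; rewrite in_cons => /orP[/eqP -> //|/Hy h]; lra.
Qed.

Variant chain_below_spec b : Prop :=
  | ChainBelow ks of adm m ks & cbase ks < b &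
      (forall ks', adm m ks' -> cbase ks' < b -> cbase ks' <= cbase ks)
  | NoChainBelow of (forall ks, adm m ks -> b <= cbase ks).

Lemma chain_belowP b : chain_below_spec b.
Proof.
have [s0|/(seq_max cbase)[ks]] := eqVneq [seq ks <- chains | cbase ks < b] [::].
  apply: NoChainBelow => ks; rewrite -mem_chains => ksc.
  rewrite leNgt; apply/negP => cb.
  have : ks \in [seq ks <- chains | cbase ks < b] by rewrite mem_filter cb.
  by rewrite s0.
rewrite mem_filter mem_chains => /andP[cb a] H; apply: (ChainBelow a cb).
by move=> ks' a' cb'; apply: H; rewrite mem_filter mem_chains cb'.
Qed.

(** The bases of finitely many chains are isolated. *)
Lemma near_same_side (x : R) (s : seq (seq nat)) :
  \forall y \near x, forall ks, ks \in s -> cbase ks != x ->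
    (cbase ks < y) = (cbase ks < x).
Proof.
elim: s => [|ks s IH]; first by near=> y.
have H : \forall y \near x, cbase ks != x -> (cbase ks < y) = (cbase ks < x).
  have [->|ne] := eqVneq (cbase ks) x; first by near=> y.
  have [lt|gt] := ltP (cbase ks) x.
    near=> y => _; near: y; exact: lt_nbhsr.
  have lt : x < cbase ks by rewrite lt_neqAle eq_sym ne.
  near=> y => _; apply/negbTE; rewrite -leNgt ltW //; near: y.
  exact: lt_nbhsl.
near=> y => ks'; rewrite in_cons => /orP[/eqP ->|ks's].
  by near: y.
by move: ks' ks's; near: y.
Unshelve. all: by end_near. Qed.

End Critical.

(** * Continuity and jumps *)

Section Jumps.
Variables (R : realType) (m : nat).
Hypothesis m1 : (1 < m)%N.
Let m0 : (0 < m)%N. Proof. exact: ltnW. Qed.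
Local Notation lo := (ext false m).
Local Notation dom := ([set` `]1, 2]] : set R).

Lemma in_dom (x : R) : dom x <-> 1 < x <= 2.
Proof. by rewrite /= in_itv. Qed.

Lemma tau_continuous (x : R) : dom x -> (forall ks, adm m ks -> cbase R m ks != x) ->
  tau m y @[y --> within dom (nbhs x)] --> tau m x.
Proof.
move=> /in_dom dx ne; have x1 : 1 < x by case/andP: dx.
have side := near_same_side m x (chains m).
suff [g [gx gc gE]] : exists g : R -> R, [/\ tau m x = g x, g y @[y --> x] --> g x &
    \forall y \near x, dom y -> tau m y = g y].
  have E : \forall y \near within dom (nbhs x), g y = tau m y.
    by apply: filterS gE => y H dy; rewrite H.
  rewrite gx; apply: cvg_trans (near_eq_cvg E) _; exact: cvg_within_filter.
have [ks a cb Hmax|H] := chain_belowP m1 x.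
  exists (pval m (lo ks)); split; first exact: tau_chain.
    exact: pval_continuous.
  apply: filterS side => y S /in_dom dy; apply: tau_chain => //.
    by rewrite S ?mem_chains ?ne.
  by move=> ks' a'; rewrite S ?mem_chains ?ne //; exact: Hmax.
exists (fun _ => 0); split; [exact: tau_no_chain|exact: cvg_cst|].
apply: filterS side => y S /in_dom dy; apply: tau_no_chain => // ks a.
by rewrite leNgt S ?mem_chains ?ne // -leNgt; exact: H.
Qed.

(** At the base of a chain the chain itself is not yet available, and the
    preceding one has a strictly smaller smallest sequence. *)
Lemma tau_jump ks : adm m ks ->
  tau m (cbase R m ks) < pval m (lo ks) (cbase R m ks).
Proof.
move=> a; have [/andP[c1 c2] _] := cbaseP R m1 a; set x := cbase R m ks in c1 c2 *.
have dx : 1 < x <= 2 by rewrite c1 ltW.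
have plo := ext_periodic false a.
have [ks' a' cb Hmax|H] := chain_belowP m1 x.
  rewrite (tau_chain m1 dx a' cb Hmax); apply: realized_slt => //.
  - exact: ext_periodic.
  - exact: cbase_realized.
  - by apply: ext_slt => //; apply/(cbase_ltP R m1 a' a).
rewrite (tau_no_chain m1 dx H); apply: pval_gt0 => //.
exact: (both_digits true m1 (ext_primitive a)).
Qed.

Lemma tau_right ks : adm m ks ->
  \forall y \near (cbase R m ks)^'+, tau m y = pval m (lo ks) y.
Proof.
move=> a; have [/andP[c1 c2] _] := cbaseP R m1 a; set x := cbase R m ks in c1 c2 *.
have side := near_same_side m x (chains m).
have side' : \forall y \near x^'+, forall ks', ks' \in chains m ->
    cbase R m ks' != x -> (cbase R m ks' < y) = (cbase R m ks' < x).
  exact: (cvg_within _ side).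
near=> y; have xy : x < y by near: y; exact: nbhs_right_gt.
have y2 : y <= 2 by near: y; exact: nbhs_right_le.
apply: tau_chain => //; first by rewrite y2 (lt_trans c1).
move=> ks' a' cb; have [->//|ne] := eqVneq (cbase R m ks') x.
have S : forall ks', ks' \in chains m ->
    cbase R m ks' != x -> (cbase R m ks' < y) = (cbase R m ks' < x).
  by near: y.
by rewrite ltW // -S // mem_chains.
Unshelve. all: by end_near. Qed.

Lemma tau_discontinuous ks : adm m ks ->
  ~ (tau m y @[y --> within dom (nbhs (cbase R m ks))] --> tau m (cbase R m ks)).
Proof.
move=> a H; have [/andP[c1 c2] _] := cbaseP R m1 a.
have J := tau_jump a; have Rt := tau_right a.
set x := cbase R m ks in H J Rt c1 c2 *.
have c3 : pval m (lo ks) y @[y --> x^'+] --> pval m (lo ks) x.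
  by apply: cvg_at_right_filter; exact: pval_continuous.
have c4 : tau m y @[y --> x^'+] --> pval m (lo ks) x.
  apply: cvg_trans c3; apply: near_eq_cvg.
  by apply: filterS Rt => y ->.
have c5 : tau m y @[y --> x^'+] --> tau m x.
  apply: cvg_trans H; apply: cvg_app => S Sx.
  have {}Sx : \forall y \near x, dom y -> S y by exact: Sx.
  have : \forall y \near x^'+, dom y -> S y by exact: (cvg_within _ Sx).
  move=> H'; apply: filterS3 H' (nbhs_right_ltW c2) (nbhs_right_gt x) => y h y2 y1.
  by apply: h; apply/in_dom; rewrite y2 (lt_trans c1 y1).
have E := cvg_unique (@norm_hausdorff _ R) c4 c5.
by rewrite E ltxx in J.
Qed.

Lemma tau_discontinuities :
  discontinuities dom (tau m : R -> R) = [set cbase R m ks | ks in [set ks | adm m ks]].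
Proof.
apply/seteqP; split=> x /=.
  move=> [dx nc]; apply: contrapT => H; apply: nc; apply: tau_continuous => // ks a.
  by apply/eqP => E; apply: H; exists ks.
move=> [ks a <-]; split; last exact: tau_discontinuous.
have [/andP[c1 c2] _] := cbaseP R m1 a.
by apply/in_dom; rewrite c1 ltW.
Qed.

Lemma card_cbase :
  ([set cbase R m ks | ks in [set ks | adm m ks]] #= `I_(psi m))%card.
Proof.
pose s := map (cbase R m) (chains m).
have -> : [set cbase R m ks | ks in [set ks | adm m ks]] = [set` [fset x in s]%fset].
  apply/seteqP; split=> x /=.
    by move=> [ks a <-]; rewrite in_fset /= map_f // (mem_chains m1).
  by rewrite in_fset /= => /mapP[ks]; rewrite (mem_chains m1) => a ->; exists ks.
apply/card_eq_fsetP; rewrite card_fseq undup_id.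
  by rewrite size_map size_chain_enum.
rewrite map_inj_in_uniq ?chain_enum_uniq // => ks ks'.
rewrite !(mem_chains m1) => a a'; exact: cbase_inj.
Qed.
End Jumps.

Lemma adm_first m : (1 < m)%N -> adm m [:: 1%N].
Proof. by move=> m1; rewrite /= m1 gcdn1. Qed.

Lemma adm_last m : (1 < m)%N -> adm m [:: m.-1].
Proof.
case: m => [|[|m]] //= _; rewrite ltnSn /=.
by rewrite -addn1 gcdnC gcdnDl gcdn1.
Qed.

Lemma clt_first m ks : (1 < m)%N -> adm m ks -> ks = [:: 1%N] \/ clt [:: 1%N] ks.
Proof.
move=> m1; case: ks => [/eqP E|[|[|k]] ks]; first by rewrite E in m1.
- by [].
- by rewrite /= gcdn1 => /andP[_ /adm1 ->]; left.
- by right.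
Qed.

Lemma clt_last m ks : (1 < m)%N -> adm m ks -> ks = [:: m.-1] \/ clt ks [:: m.-1].
Proof.
move=> m1 a; have [k [ks' E]] := adm_cons m1 a; rewrite E in a *.
have [km|km] := ltnP k m.-1; first by right; rewrite /= km.
have {}km : k = m.-1 by case/andP: a => /andP[]; lia.
left; rewrite km in a *; case/andP: a => _; have /andP[_ /eqP ->] := adm_last m1.
by move/adm1 => ->.
Qed.

Theorem theorem1p3 (R : realType) (m : nat) (hm : (2 <= m)%N) :
  [/\ forall b : R, 1 < b <= 2 -> 0 <= tau m b < 1,
      (discontinuities `]1, 2] (tau m : R -> R) #= `I_(psi m))%card,
      discontinuities `]1, 2] (tau m : R -> R)
        = [set chain_base c | c in admissible m],
      forall c c' : seq nat, admissible m c -> admissible m c' ->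
        ((chain_base c : R) < chain_base c' <-> chain_lt c c')
    & [/\ forall b : R, 1 < b <= chain_base [:: m; 1%N] -> tau m b = 0,
          forall b : R, chain_base [:: m; m.-1] < b <= 2 ->
            tau m b = expansion (wpow (farey m.-1 m)) b
        & forall (c : seq nat) (b : R),
            admissible m c -> c <> [:: m; m.-1] -> partition_interval m c b ->
            tau m b = expansion (wpow (chain_word c)) b]].
Proof.
have m0 : (0 < m)%N by exact: ltnW.
have chain_ltP ks ks' : chain_lt (m :: ks) (m :: ks') <-> clt ks ks'.
  by rewrite chain_ltE /= ltnn eqxx.
have tauE ks b : 1 < b <= 2 -> adm m ks -> cbase R m ks < b ->
    (forall ks', adm m ks' -> cbase R m ks' < b -> cbase R m ks' <= cbase R m ks) ->
    tau m b = expansion (wpow (chain_word (m :: ks))) b.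
  move=> hb a cb H; rewrite (tau_chain hm hb a cb H) chain_word_adm //.
  by rewrite (pval_expansion m0 _ (ext_periodic false a)) //; case/andP: hb.
split; last split.
- move=> b hb; have b1 : 1 < b by case/andP: hb.
  have [ks a cb H|H] := chain_belowP hm b; last by rewrite tau_no_chain ?lexx ?ltr01.
  rewrite (tau_chain hm hb a cb H) pval_ge0 //=.
  by have := cbase_realized hm a cb 0; rewrite shiftseq0.
- by rewrite tau_discontinuities //; exact: card_cbase.
- rewrite tau_discontinuities //; apply/seteqP; split=> x [c a <-].
    by exists (m :: c) => //; apply/admissibleE; exists c.
  by move/admissibleE: a => [ks -> a]; exists ks.
- move=> c c' /admissibleE[ks -> a] /admissibleE[ks' -> a'].
  by rewrite chain_ltP; exact: cbase_ltP.
- move=> b /andP[b1 b2]; have a1 := adm_first hm.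
  have [/andP[_ c2] _] := cbaseP R hm a1; rewrite -/(cbase R m [:: 1%N]) in b2.
  apply: (tau_no_chain hm) => [|ks a]; first by rewrite b1; lra.
  by case: (clt_first hm a) => [-> //|/(cbase_slt R hm a1 a)]; lra.
- move=> b /andP[cb b2]; have a1 := adm_last hm.
  have [/andP[c1 _] _] := cbaseP R hm a1; rewrite -/(cbase R m [:: m.-1]) in cb.
  rewrite -chain_word1; apply: tauE => //; first by rewrite b2 andbT; lra.
  move=> ks a _; case: (clt_last hm a) => [-> //|/(cbase_slt R hm a a1)]; exact: ltW.
move=> _ b /admissibleE[ks -> a] _ [_ [_ /admissibleE[ks' -> a'] /chain_ltP c gap]].
rewrite -/(cbase R m ks) -/(cbase R m ks') => /andP[cb cb'].
have [/andP[c1 _] _] := cbaseP R hm a; have [/andP[_ c2] _] := cbaseP R hm a'.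
apply: tauE => //; first by apply/andP; split; lra.
move=> ks2 a2 cb2; rewrite leNgt; apply/negP => lt; apply: gap.
exists (m :: ks2); split; first by apply/admissibleE; exists ks2.
  by apply/chain_ltP/(cbase_ltP R hm a a2).
by apply/chain_ltP/(cbase_ltP R hm a2 a'); exact: lt_le_trans cb'.
Qed.
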